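(* For every integer $n\ge 3$ there exist constants $C=C(n)<\infty$ and $\theta=\theta(n)\in(0,1)$, independent of $m$, such that the following holds for every integer $m\ge 2$. Sample a uniform spanning tree $T$ of $G_{n,m}=C_n\times P_m$ by Wilson's algorithm, with the root being a vertex of one of the two boundary rings $R_0,R_{m-1}$ and with the first random walk started from a vertex of the other boundary ring, and let $L\subset T$ be the first loop-erased path produced by the algorithm. Then for every fixed vertex $v\in V(G_{n,m})$ and every integer $l\ge 0$, $$\mathbb P\bigl(d_T(v,L)\ge l\bigr)\le C\,\theta^{\,l}.$$
   Context: For $n\ge 3$, $m\ge 2$, the cylindrical graph $G_{n,m}=C_n\times P_m$ has vertex set $\{(i,j): i\in\mathbb{Z}_n,\ j\in\{0,\dots,m-1\}\}$ and edges $\{(i,j),(i+1,j)\}$ ($i\in\mathbb{Z}_n$, $0\le j\le m-1$) and $\{(i,j),(i,j+1)\}$ ($i\in\mathbb{Z}_n$, $0\le j\le m-2$). Its rings are $R_k=\{(i,k): i\in\mathbb{Z}_n\}$, $k=0,\dots,m-1$; the boundary rings are $R_0$ and $R_{m-1}$. Loop-erasure: for a finite path $\gamma$, its (chronological) loop-erasure is obtained by iteratively erasing cycles in chronological order: whenever the path first revisits a vertex, delete the loop formed between the two occurrences. Wilson's algorithm on a finite connected graph $G=(V,E)$: choose a root $r\in V$ and an ordering of $V\setminus\{r\}$. Starting with the tree $\{r\}$, repeatedly take the first vertex in the ordering not yet in the current tree, run (independently of the past) simple random walk from it (each step moves to a uniformly chosen neighbour) until it first hits the current tree, and add the loop-erasure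 of this walk to the tree. The final tree is a uniform spanning tree (uniformly distributed among all spanning trees). $d_T$ denotes graph distance in $T$, and $d_T(v,L)=\min_{u\in V(L)} d_T(v,u)$. *)

(* Defs.v *)
From HB Require Import structures.
From mathcomp Require Import all_boot all_order all_algebra.
From mathcomp Require Import all_classical all_reals all_analysis.

Set Implicit Arguments.
Unset Strict Implicit.
Unset Printing Implicit Defensive.

Import Order.TTheory GRing.Theory Num.Theory.
Local Open Scope ring_scope.

Section Cylinder.

Definition cyl (n m : nat) : finType := ('Z_n * 'I_m)%type.

(* ['Z_n] is the integers mod [n] only for [2 <= n], and the graph below is
   C_n x P_m only for [3 <= n]. *)
Definition cyl_adj (n m : nat) : rel (cyl n m) := fun u v =>
  ((u.2 == v.2) && ((v.1 == u.1 + 1) || (u.1 == v.1 + 1))) ||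
  ((u.1 == v.1) && ((v.2 == u.2.+1 :> nat) || (u.2 == v.2.+1 :> nat))).

Definition ring_of (n m k : nat) : {set cyl n m} :=
  [set v : cyl n m | v.2 == k :> nat]%SET.

End Cylinder.

Section LoopErasure.
Variable V : finType.

(* [s] is the loop-erasure of the path read so far and [x] is the next vertex:
   if [x] closes a loop, what follows the earlier occurrence of [x] is erased. *)
Definition loop_erase_step (s : seq V) (x : V) : seq V :=
  if x \in s then take (index x s).+1 s else rcons s x.

Definition loop_erasure (p : seq V) : seq V := foldl loop_erase_step [::] p.

End LoopErasure.

Section Wilson.
Variable V : finType.

(* The trajectory up to and including its first hit of [A]; the value [::] is
   used only if [A] is never hit. *)
Definition stopped_path (A : {set V}) (w : nat -> V) : seq V :=
  if pselect (exists k, w k \in A) is left hitA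
  then mkseq w (ex_minn hitA).+1 else [::].

Definition branch (A : {set V}) (w : nat -> V) : seq V :=
  loop_erasure (stopped_path A w).

(* Subgraphs are pairs (vertices, edges), an edge being an unordered pair. *)
Definition subgraph : Type := ({set V} * {set {set V}})%type.

Definition path_edges (s : seq V) : {set {set V}} :=
  [set [set z.1; z.2] | z in zip s (behead s)]%SET.

Definition add_path (t : subgraph) (s : seq V) : subgraph :=
  (t.1 :|: [set y in s], t.2 :|: path_edges s)%SET.

(* [w x] is the trajectory of the walk started at [x]; it is used only if [x]
   is not yet in the tree when its turn comes. *)
Definition wilson_step (w : V -> nat -> V) (t : subgraph) (x : V) : subgraph :=
  if x \in t.1 then t else add_path t (branch t.1 (w x)).

Definition wilson (w : V -> nat -> V) (r : V) (ord : seq V) : subgraph :=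
  foldl (wilson_step w) ([set r]%SET, finset.set0) ord.

Definition sg_adj (t : subgraph) : rel V := fun x y => [set x; y]%SET \in t.2.

(* Graph distance; it is [#|V|] if there is no path from [x] to [y]. *)
Definition gdist (e : rel V) (x y : V) : nat :=
  find (fun k => [exists p : k.-tuple V, path e x p && (last x p == y)])
       (iota 0 #|V|).

Definition gdist_to (e : rel V) (x : V) (s : seq V) : nat :=
  \big[minn/#|V|]_(u <- s) gdist e x u.

End Wilson.

Section RandomWalks.
Variables (V : finType) (e : rel V).
Variables (R : realType) (d : measure_display) (Omega : measurableType d).
Variable P : probability Omega R.

Definition step_prob (x y : V) : R :=
  if e x y then (#|[set z | e x z]%SET|%:R)^-1 else 0.

Definition follows (X : nat -> Omega -> V) (p : nat -> V) (k : nat) :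
    set Omega :=
  [set w | forall i, (i <= k)%N -> X i w = p i]%classic.

Definition srw (x : V) (X : nat -> Omega -> V) : Prop :=
  [/\ forall k y, measurable [set w | X k w = y]%classic,
      P [set w | X 0%N w = x]%classic = 1%E
    & forall (p : nat -> V) (k : nat),
        P (follows X p k.+1) =
        (P (follows X p k) * (step_prob (p k) (p k.+1))%:E)%E].

Definition process_sigma (X : nat -> Omega -> V) : set (set Omega) :=
  (<<s [set A | exists k y, A = [set w | X k w = y]] >>)%classic.

(* Since an event may be the whole space, this product rule includes those for
   subfamilies. *)
Definition mutually_independent (D : {set V}) (X : V -> nat -> Omega -> V) :
    Prop :=
  forall A : V -> set Omega,
    (forall x, x \in D -> process_sigma (X x) (A x)) ->
    P [set w | forall x, x \in D -> A x w]%classic =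
    (\prod_(x in D) P (A x))%E.

(* The walks used by Wilson's algorithm rooted at [r], one for each possible
   starting vertex. *)
Definition wilson_walks (r : V) (X : V -> nat -> Omega -> V) : Prop :=
  (forall x, x != r -> srw x (X x)) /\ mutually_independent [set~ r]%SET X.

End RandomWalks.

(* Main.v *)
(** Wilson's algorithm with the first branch [L] prescribed is insensitive to
    the order of the later vertices: the loop-erasure of a walk started at [x]
    and stopped on [A] equals a given path [g] with probability
    (weight of [g]) * Z(A u g) / Z(A), where Z(A) is the determinant of [1 - p]
    restricted to the complement of [A]. Along a run these ratios telescope, so
    every tree oriented towards the root [r] has probability
    (product of its step probabilities) / Z(r), whatever the order.

    One may therefore explore [v] right after [s]. The distance from [v] to [L]
    is then at most the hitting time of [L] by the walk from [v]. Since [L]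
    joins the two boundary rings it meets every ring, so from anywhere the walk
    hits [L] within [n] steps with probability at least (1/4)^n, and the hitting
    time has a geometric tail that does not depend on [m]. *)

Require Import Defs.
From HB Require Import structures.
From mathcomp Require Import all_boot all_order all_algebra.
From mathcomp Require Import all_classical all_reals all_analysis.
From mathcomp Require Import ring lra zify.

Set Implicit Arguments.
Unset Strict Implicit.
Unset Printing Implicit Defensive.

Import Order.TTheory GRing.Theory Num.Theory.
Import numFieldNormedType.Exports.
Local Open Scope ring_scope.

(** * Loop erasure *)

(** The change of order is forced by the arbitrary place of [v]: when its turn comes, the tree may
    have grown well beyond the first branch, and the branch of [v] may attach far from it. The
    exchange is made for the pair (tree, first branch) with [s] kept first, so that no conditional
    law is needed.

    Trees are encoded by parent functions. A run is compared with a fixed parent function, so the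
    target of every walk is known in advance and the event splits into independent ones; almost
    surely exactly one parent function agrees with the run.

    The law of one branch is not found by summing over walks. The loop-erasure of the past is itself
    a Markov chain, and a bounded function harmonic along it with the right values at absorption
    must be the wanted probability, because survival decays geometrically; exhibiting one such
    function suffices.

    Absorption at the root may be slow when [m] is large, but it only makes limits vanish and
    determinants nonzero: its rate never enters the bound. *)

Section LoopErasureTheory.
Variable V : finType.
Implicit Types (s p g : seq V) (x y : V) (A : {set V}) (w : nat -> V).

Lemma loop_erase_stepE s x :
  loop_erase_step s x = rcons (take (index x s) s) x.
Proof.
rewrite /loop_erase_step; case: ifP => xs.
  by rewrite (take_nth x) ?index_mem // nth_index.
by rewrite memNindex ?xs // take_size.
Qed.

Lemma loop_erase_step_notin s x :
  x \notin s -> loop_erase_step s x = rcons s x.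
Proof. by rewrite /loop_erase_step => /negbTE ->. Qed.

Lemma loop_erase_step_self s x : loop_erase_step (x :: s) x = [:: x].
Proof. by rewrite /loop_erase_step inE eqxx /= eqxx take0. Qed.

Lemma loop_erase_step_cons s x y :
  x != y -> loop_erase_step (x :: s) y = x :: loop_erase_step s y.
Proof. by move=> xy; rewrite !loop_erase_stepE /= (negbTE xy). Qed.

Lemma notin_take_index s x : x \notin take (index x s) s.
Proof.
have [xs|/negP xs] := boolP (x \in s); last first.
  by apply/negP => /mem_take.
by rewrite in_take // ltnn.
Qed.

Lemma uniq_loop_erase_step s x : uniq s -> uniq (loop_erase_step s x).
Proof.
by move=> us; rewrite loop_erase_stepE rcons_uniq notin_take_index take_uniq.
Qed.

Lemma loop_erasure_rcons p x :
  loop_erasure (rcons p x) = loop_erase_step (loop_erasure p) x.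
Proof. by rewrite /loop_erasure foldl_rcons. Qed.

Lemma uniq_loop_erasure p : uniq (loop_erasure p).
Proof.
elim/last_ind: p => // p x IH; rewrite loop_erasure_rcons.
exact: uniq_loop_erase_step.
Qed.

Lemma mem_loop_erasure p : {subset loop_erasure p <= p}.
Proof.
elim/last_ind: p => // p x IH y; rewrite loop_erasure_rcons loop_erase_stepE.
rewrite !mem_rcons !inE => /orP[->//|/mem_take /IH ->]; exact: orbT.
Qed.

Lemma loop_erasure_id p : uniq p -> loop_erasure p = p.
Proof.
elim/last_ind: p => // p x IH; rewrite rcons_uniq => /andP[xp up].
by rewrite loop_erasure_rcons IH // loop_erase_step_notin.
Qed.

Lemma size_loop_erasure p : (size (loop_erasure p) <= size p)%N.
Proof.
elim/last_ind: p => // p x IH.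
rewrite loop_erasure_rcons loop_erase_stepE !size_rcons ltnS.
by apply: leq_trans IH; rewrite size_take; case: ltnP => // /ltnW.
Qed.

Lemma path_loop_erasure (e : rel V) x p : path e x p ->
  exists q, [/\ loop_erasure (x :: p) = x :: q, path e x q
              & last x q = last x p].
Proof.
elim/last_ind: p => [|p y IH]; first by exists [::].
rewrite rcons_path => /andP[/IH[q [E pq lq]] exy].
rewrite -rcons_cons loop_erasure_rcons E last_rcons.
have [<-|xy] := eqVneq x y; first by rewrite loop_erase_step_self; exists [::].
rewrite loop_erase_step_cons // loop_erase_stepE.
exists (rcons (take (index y q) q) y); split=> //; last by rewrite last_rcons.
have [yq|yq] := boolP (y \in q).
  have := pq; rewrite -{1}(cat_take_drop (index y q).+1 q) cat_path.
  by case/andP; rewrite (take_nth y) ?index_mem // nth_index.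
by rewrite memNindex // take_size rcons_path pq lq.
Qed.

(** The possible branches from [x] to [A]: simple paths that meet [A] only at their last vertex. If
    [x] is in [A], only the trivial path qualifies. *)
Definition ends_first_in A x g :=
  [&& uniq (x :: g), all [predC A] (belast x g) & last x g \in A].

Lemma ends_first_in_nil A x : ends_first_in A x [::] = (x \in A).
Proof. by rewrite /ends_first_in. Qed.

Lemma ends_first_in_cons A x y g : ends_first_in A x (y :: g) ->
  [/\ x \notin A, x \notin y :: g & ends_first_in (x |: A) y g].
Proof.
move=> /and3P[]; rewrite cons_uniq => /andP[xg ug] /= /andP[xA aA] lA; split=> //.
rewrite /ends_first_in ug in_setU1 lA orbT andbT.
apply/allP => z zg; have zA : z \notin A := allP aA z zg.
rewrite !inE negb_or zA andbT.
by apply: contraNneq xg => <-; exact: mem_belast.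
Qed.

Lemma ends_first_in_out A x g : ends_first_in A x g ->
  [set y in x :: g]%SET :\: A = [set y in belast x g]%SET.
Proof.
case/and3P=> _ aA lA; apply/setP => y; rewrite !inE -in_cons lastI mem_rcons in_cons.
apply/andP/idP => [[yA /orP[/eqP yE|//]]|yg].
  by rewrite yE lA in yA.
by split; [exact: (allP aA)|rewrite yg orbT].
Qed.

Lemma stopped_pathE A w (hA : exists k, w k \in A) :
  stopped_path A w = mkseq w (ex_minn hA).+1.
Proof.
rewrite /stopped_path; case: pselect => // h; congr (mkseq w _.+1).
by apply: eq_ex_minn.
Qed.

Lemma stopped_path_first A w t :
  w t \in A -> (forall k, (k < t)%N -> w k \notin A) ->
  stopped_path A w = mkseq w t.+1.
Proof.
move=> wt wk; have hA : exists k, w k \in A by exists t.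
rewrite stopped_pathE; congr (mkseq w _.+1).
case: ex_minnP => j wj jmin; apply/eqP; rewrite eqn_leq jmin // leqNgt.
by apply/negP => /wk; rewrite wj.
Qed.

Lemma first_hit A w : (exists k, w k \in A) ->
  exists2 t, w t \in A & forall k, (k < t)%N -> w k \notin A.
Proof.
move=> hA; exists (ex_minn hA); first by case: ex_minnP.
by move=> k; case: ex_minnP => t _ tmin kt; apply: contraTN kt => /tmin; rewrite -leqNgt.
Qed.

Lemma mkseq_cons w t : mkseq w t.+1 = w 0%N :: mkseq (fun k => w k.+1) t.
Proof. by rewrite /mkseq /= (iotaDl 1) -map_comp. Qed.

Lemma mkseq_rcons w t : mkseq w t.+1 = rcons (mkseq w t) (w t).
Proof. by rewrite /mkseq -addn1 iotaD map_cat cats1. Qed.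

Lemma path_mkseq (e : rel V) w t : (forall k, e (w k) (w k.+1)) ->
  path e (w 0%N) (mkseq (fun k => w k.+1) t).
Proof.
move=> ew; elim: t => // t IH; rewrite mkseq_rcons rcons_path IH.
case: t {IH} => [|t]; first by rewrite /= ew.
by rewrite mkseq_rcons last_rcons /= ew.
Qed.

(** Erasing loops only shortens a path, hence the last clause: a branch with [l] steps or more
    forces the walk to avoid [A] at all times before [l]. This is how lengths in the tree become
    hitting times. *)
Lemma branch_ends (e : rel V) A w : (exists k, w k \in A) ->
    (forall k, e (w k) (w k.+1)) ->
  exists g, [/\ branch A w = w 0%N :: g, ends_first_in A (w 0%N) g,
    path e (w 0%N) g &
    forall l, (l <= size g)%N -> forall k, (k < l)%N -> w k \notin A].
Proof.
move=> /first_hit[t wt wmin] ew.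
rewrite /branch (stopped_path_first wt wmin) mkseq_cons.
have [q [Eq pq lq]] := path_loop_erasure (path_mkseq t ew).
exists q; split=> //; last first.
  move=> l lq' k kl; apply: wmin; apply: leq_trans kl (leq_trans lq' _).
  by have := size_loop_erasure (w 0%N :: mkseq (fun k => w k.+1) t); rewrite Eq /= size_mkseq.
have uq : uniq (w 0%N :: q) by rewrite -Eq uniq_loop_erasure.
have lE : last (w 0%N) q = w t.
  rewrite lq; case: (t) => // t'; by rewrite mkseq_rcons last_rcons.
rewrite /ends_first_in uq lE wt andbT.
apply/allP => y yq; rewrite inE.
have : y \in mkseq w t.+1.
  by rewrite mkseq_cons; apply: mem_loop_erasure; rewrite Eq mem_belast.
case/mapP => k; rewrite mem_iota /= add0n ltnS leq_eqVlt => /orP[/eqP-> yE|kt ->]; last exact: wmin.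
have := uq; rewrite lastI rcons_uniq lE -yE yq.
by [].
Qed.

Lemma branch_ends_first A w : (exists k, w k \in A) ->
  exists g, [/\ branch A w = w 0%N :: g, ends_first_in A (w 0%N) g &
    forall l, (l <= size g)%N -> forall k, (k < l)%N -> w k \notin A].
Proof.
move=> hA; have [//|g [? ? _ ?]] := @branch_ends (fun _ _ => true) A w hA.
by exists g.
Qed.

(** The iterates of [f] up to [A] are already self-avoiding, so nothing is erased. A parent function
    can thus be fed to the algorithm as a deterministic trajectory. *)
Lemma branch_traject (f : V -> V) A x g :
  ends_first_in A x g -> fpath f x g ->
  branch A (fun k => iter k f x) = x :: g.
Proof.
move=> /and3P[ug aA lA] /fpathP[n En].
have Et : mkseq (fun k => iter k f x) n.+1 = x :: g.
  by rewrite En -trajectS; apply: (@eq_from_nth _ x) => [|i]; rewrite size_mkseq ?size_traject // => ?; rewrite nth_mkseq // nth_traject.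
have sg : size g = n by rewrite En size_traject.
rewrite /branch (@stopped_path_first _ _ n) ?Et ?loop_erasure_id //.
  by move: lA; rewrite En last_traject.
move=> k kn; suff /(allP aA) : iter k f x \in belast x g by [].
have -> : iter k f x = nth x (x :: g) k by rewrite -Et nth_mkseq // ltnW.
rewrite lastI nth_rcons size_belast sg kn.
by rewrite mem_nth // size_belast sg.
Qed.

End LoopErasureTheory.

(** * Killed walks and determinants *)

Section Survival.
Variables (R : realType) (V : finType) (p : V -> V -> R).
Implicit Types (A B : {set V}) (x y : V).
Hypothesis p_ge0 : forall x y, 0 <= p x y.
Hypothesis p_sum1 : forall x, \sum_y p x y = 1.

(** The probability that the chain with kernel [p] started at [x] avoids [A] at all times from 0 to
    [k], both included. *)
Fixpoint surv A k x : R :=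
  if x \in A then 0 else
  if k is k'.+1 then \sum_y p x y * surv A k' y else 1.

Lemma surv_in A k x : x \in A -> surv A k x = 0.
Proof. by case: k => [|k] /= ->. Qed.

Lemma surv_ge0 A k x : 0 <= surv A k x.
Proof.
elim: k x => [|k IH] x /=; case: ifP => //= _.
by apply: sumr_ge0 => y _; rewrite mulr_ge0.
Qed.

Lemma avg_le (f : V -> R) b x : (forall y, f y <= b) ->
  \sum_y p x y * f y <= b.
Proof.
move=> fb; rewrite -[leRHS]mul1r -(p_sum1 x) mulr_suml.
by apply: ler_sum => y _; rewrite ler_wpM2l.
Qed.

Lemma surv_le1 A k x : surv A k x <= 1.
Proof.
elim: k x => [|k IH] x /=; case: ifP => //= _; exact: avg_le.
Qed.

Lemma surv_anti A k l x : (k <= l)%N -> surv A l x <= surv A k x.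
Proof.
elim: k l x => [|k IH] l x.
  move=> _; have [xA|xA] := boolP (x \in A); first by rewrite !surv_in.
  by rewrite [leRHS]/= (negbTE xA) surv_le1.
case: l => // l kl /=; case: ifP => // _.
by apply: ler_sum => y _; rewrite ler_wpM2l // IH.
Qed.

(** Markov property at time [l], with the worst position at that time. *)
Lemma surv_addn A b k l x : (forall y, surv A k y <= b) ->
  surv A (l + k) x <= surv A l x * b.
Proof.
move=> kb; elim: l x => [|l IH] x.
  have [xA|xA] := boolP (x \in A); first by rewrite !surv_in ?mul0r.
  by rewrite add0n [X in X * _]/= (negbTE xA) mul1r.
rewrite addSn /=; case: ifP => _; first by rewrite mul0r.
by rewrite mulr_suml; apply: ler_sum => y _; rewrite -mulrA ler_wpM2l.
Qed.

Lemma surv_exp A q k j x : (forall y, surv A k y <= q) ->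
  surv A (j * k) x <= q ^+ j.
Proof.
move=> kq; have q0 : 0 <= q by apply: le_trans (kq x); rewrite surv_ge0.
elim: j => [|j IH]; first by rewrite mul0n expr0 surv_le1.
rewrite mulSn addnC exprSr; apply: le_trans (surv_addn _ _ kq) _.
by rewrite ler_wpM2r.
Qed.

(** A quantitative form of almost sure hitting: by [surv_exp], one uniform gap at one time already
    gives geometric decay. *)
Definition absorbing A := exists k q, q < 1 /\ forall x, surv A k x <= q.

Lemma surv_mono A B k x : A \subset B -> surv B k x <= surv A k x.
Proof.
move=> sAB; elim: k x => [|k IH] x /=; (case: ifP => xB;
  first by case: ifP => // _; rewrite ?ler01 // sumr_ge0 // => y _; rewrite mulr_ge0 ?surv_ge0).
  by rewrite (contraFF (fintype.subsetP sAB x)).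
rewrite (contraFF (fintype.subsetP sAB x)) //.
by apply: ler_sum => y _; rewrite ler_wpM2l.
Qed.

Lemma absorbingS A B : A \subset B -> absorbing A -> absorbing B.
Proof.
move=> sAB [k [q [q1 Aq]]]; exists k, q; split=> // x.
exact: le_trans (surv_mono _ _ sAB) (Aq x).
Qed.

(** The passage to the limit shared by all later arguments: a discrepancy controlled at every
    horizon by the survival probability is zero. *)
Lemma surv_lim A a M x : absorbing A ->
  (forall k, a <= M * surv A k x) -> a <= 0.
Proof.
move=> [k [q [q1 Aq]]] aM.
have q0 : 0 <= q by apply: le_trans (Aq x); rewrite surv_ge0.
have aq j : a <= `|M| * q ^+ j.
  apply: le_trans (aM (j * k)%N) _; apply: (@le_trans _ _ (`|M| * surv A (j * k) x)).
    by rewrite ler_wpM2r ?surv_ge0 // ler_norm.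
  by rewrite ler_wpM2l // surv_exp.
rewrite leNgt; apply/negP => a0.
have cv : ((fun j => `|M| * q ^+ j) @ \oo --> `|M| * 0)%classic.
  by apply: cvgM; [exact: cvg_cst|apply: cvg_expr; rewrite ger0_norm].
move/cvgrPdist_lt: cv => /(_ a a0)[N _ /(_ N)].
rewrite mulr0 sub0r normrN /= => /(_ (leqnn N)).
by rewrite ger0_norm ?mulr_ge0 ?exprn_ge0 // ltNge aq.
Qed.

(** Using the equation [k] times bounds [u] by its sup norm times the probability of surviving [k]
    steps. *)
Lemma harmonic_eq0 A (u : V -> R) : absorbing A ->
  (forall x, x \in A -> u x = 0) ->
  (forall x, x \notin A -> u x = \sum_y p x y * u y) ->
  forall x, u x = 0.
Proof.
move=> aA uA uH x.
pose M := \sum_y `|u y|.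
have uM y : `|u y| <= M by rewrite /M (bigD1 y) //= lerDl sumr_ge0.
have bound k y : `|u y| <= M * surv A k y.
  elim: k y => [|k IH] y; have [yA|yA] := boolP (y \in A).
  - by rewrite surv_in // uA // normr0 mulr0.
  - by rewrite /= (negbTE yA) mulr1.
  - by rewrite surv_in // uA // normr0 mulr0.
  rewrite uH //= (negbTE yA) mulr_sumr.
  apply: le_trans (ler_norm_sum _ _ _) _; apply: ler_sum => z _.
  by rewrite normrM (ger0_norm (p_ge0 _ _)) mulrCA ler_wpM2l.
apply/eqP; rewrite -normr_le0; exact: (surv_lim aA (fun k => bound k x)).
Qed.

(** Rows in [A] are rows of the identity, so the determinant is that of [1 - p] restricted to the
    complement of [A], while the size of the matrix does not depend on [A]. *)
Definition killed_mx A : 'M[R]_#|V| :=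
  \matrix_(i, j) ((i == j)%:R -
    (if enum_val i \in A then 0 else p (enum_val i) (enum_val j))).

Definition kdet A := \det (killed_mx A).

Lemma kdetT : kdet [set: V]%SET = 1.
Proof.
rewrite /kdet (_ : killed_mx _ = 1%:M) ?det1 //.
by apply/matrixP => i j; rewrite !mxE inE subr0.
Qed.

Lemma killed_mx_mul A (u : 'cV[R]_#|V|) i : (killed_mx A *m u) i ord0 =
  u i ord0 - (if enum_val i \in A then 0
              else \sum_y p (enum_val i) y * u (enum_rank y) ord0).
Proof.
rewrite mxE; under eq_bigr do rewrite mxE mulrBl.
rewrite sumrB; congr (_ - _).
  rewrite (bigD1 i) //= eqxx mul1r big1 ?addr0 // => j /negbTE ji.
  by rewrite eq_sym ji mul0r.
case: ifP => _; first by rewrite big1 // => j _; rewrite mul0r.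
rewrite (reindex enum_rank) /=; last by apply: onW_bij; exact: enum_rank_bij.
by apply: eq_bigr => y _; rewrite enum_rankK.
Qed.

(** A null vector would vanish on [A] and be harmonic off [A]. The transpose is taken because
    [det0P] provides a left null vector. *)
Lemma kdet_neq0 A : absorbing A -> kdet A != 0.
Proof.
move=> aA; rewrite /kdet -det_tr; apply/negP => /det0P[v v0 vM].
case/negP: v0; apply/eqP/rowP => i; rewrite mxE.
have {}vM : killed_mx A *m v^T = 0 by rewrite -[killed_mx A]trmxK -trmx_mul vM trmx0.
have vE x := congr1 (fun M : 'cV[R]_#|V| => M (enum_rank x) ord0) vM.
rewrite -(enum_valK i).
apply: (@harmonic_eq0 A (fun x => v ord0 (enum_rank x)) aA) => x xA.
  by move: (vE x); rewrite killed_mx_mul enum_rankK xA subr0 !mxE.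
move: (vE x); rewrite killed_mx_mul enum_rankK (negbTE xA) !mxE => /eqP.
by rewrite subr_eq0 => /eqP ->; apply: eq_bigr => y _; rewrite mxE.
Qed.

(* [rho y] is the probability that the walk from [y] visits [x] no later than
   [A]; the last identity is Cramer's rule for its value at [x]. *)
Lemma return_prob A x : absorbing A -> x \notin A -> exists rho : V -> R,
  [/\ forall y, y \in A -> rho y = 0, rho x = 1,
      forall y, y \notin x |: A -> rho y = \sum_z p y z * rho z
    & 1 - \sum_z p x z * rho z = kdet A / kdet (x |: A)].
Proof.
move=> aA xA; set B := x |: A.
have aB : absorbing B by apply: absorbingS aA; exact: finset.subsetUr.
pose i := enum_rank x; pose N := killed_mx B.
have NU : N \in unitmx by rewrite unitmxE unitfE kdet_neq0.
have [u Nu] : exists u : 'cV[R]_#|V|, N *m u = delta_mx i ord0.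
  by exists (invmx N *m delta_mx i ord0); rewrite mulKVmx.
pose rho y := u (enum_rank y) ord0.
have Nuy y : (y == x)%:R = rho y - (if y \in B then 0 else \sum_z p y z * rho z).
  have := congr1 (fun M : 'cV[R]_#|V| => M (enum_rank y) ord0) Nu.
  by rewrite killed_mx_mul enum_rankK mxE eqxx andbT (inj_eq enum_rank_inj) => <-.
have rhoA y : y \in A -> rho y = 0.
  move=> yA; have := Nuy y; rewrite in_setU1 yA orbT subr0 => <-.
  by case: eqP => // yx; move: yA; rewrite yx (negbTE xA).
have rhox : rho x = 1 by have := Nuy x; rewrite in_setU1 eqxx subr0.
have rhoH y : y \notin B -> rho y = \sum_z p y z * rho z.
  move=> yB; have := Nuy y; rewrite (negbTE yB).
  have -> : (y == x) = false by apply: contraNF yB => /eqP ->; rewrite in_setU1 eqxx.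
  by move/eqP; rewrite eq_sym subr_eq0 => /eqP.
exists rho; split=> //.
set c := 1 - _.
(* [killed_mx A] and [N] differ only in the row of [x], so [u] is still sent to a multiple of the
   same basis vector. *)
have Mu : killed_mx A *m u = c *: delta_mx i ord0.
  apply/colP => j; rewrite killed_mx_mul !mxE eqxx andbT.
  have -> : (j == i) = (enum_val j == x) by rewrite -(inj_eq enum_val_inj) enum_rankK.
  have -> : u j ord0 = rho (enum_val j) by rewrite /rho enum_valK.
  set y := enum_val j; have [->|yx] := eqVneq y x.
    by rewrite (negbTE xA) mulr1 rhox.
  rewrite mulr0; case: ifP => yA; first by rewrite rhoA // subr0.
  by rewrite rhoH ?subrr // in_setU1 negb_or yx yA.
(* This cofactor ignores the row of [x], the only one in which the matrices differ; for [N] that row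
   is a unit row, so the cofactor is the whole determinant. *)
have cof : cofactor (killed_mx A) i i = cofactor N i i.
  rewrite /cofactor; congr (_ * \det _); apply/matrixP => a b; rewrite !mxE.
  rewrite in_setU1 (_ : (_ == x) = false) //.
  by apply/negbTE; rewrite -(enum_rankK x) (inj_eq enum_val_inj) eq_sym neq_lift.
have cofN : cofactor N i i = kdet B.
  have rowB j : killed_mx B i j = (i == j)%:R.
    by rewrite mxE enum_rankK in_setU1 (eqxx x) subr0.
  rewrite /kdet (expand_det_row _ i) (bigD1 i) //= rowB eqxx mul1r.
  by rewrite big1 ?addr0 // => j ji; rewrite rowB eq_sym (negbTE ji) mul0r.
have : kdet A * rho x = c * kdet B.
  have := congr1 (fun u : 'cV[R]_#|V| => (\adj (killed_mx A) *m u) i ord0) Mu.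
  rewrite mulmxA mul_adj_mx mul_scalar_mx mxE => ->.
  rewrite -scalemxAr mxE -colE !mxE; congr (_ * _).
  by rewrite cof cofN.
by rewrite rhox mulr1 => ->; rewrite mulfK // kdet_neq0.
Qed.

End Survival.

(** * The law of a loop-erased walk *)

Section LoopErasedLaw.
Variables (R : realType) (V : finType) (p : V -> V -> R).
Implicit Types (A B : {set V}) (x y : V) (g s : seq V).
Hypothesis p_ge0 : forall x y, 0 <= p x y.
Hypothesis p_sum1 : forall x, \sum_y p x y = 1.

Fixpoint path_weight x g : R :=
  if g is y :: g' then p x y * path_weight y g' else 1.

Lemma loop_erase_step_head x s y :
  exists t, loop_erase_step (x :: s) y = x :: t.
Proof.
have [<-|xy] := eqVneq x y; first by exists [::]; rewrite loop_erase_step_self.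
by rewrite loop_erase_step_cons //; eexists.
Qed.

(* [h s] is the probability that the walk stopped on [A] has loop-erasure
   [x :: g], given that the loop-erasure of its past is [s]. *)
Definition lerw_harmonic A x g (h : seq V -> R) (M : R) :=
  [/\ forall s y, uniq s -> all [predC A] s -> y \in A ->
        h (rcons s y) = (rcons s y == x :: g)%:R,
      forall s y, uniq (rcons s y) -> all [predC A] (rcons s y) ->
        h (rcons s y) = \sum_z p y z * h (loop_erase_step (rcons s y) z),
      forall y s, y != x -> h (y :: s) = 0
    & forall s, `|h s| <= M].

(* Decompose at the returns to [x]: between them the erasure is [x] followed by
   that of a walk stopped on [x |: A]. *)
Lemma lerw_harmonic_exists A x g : absorbing p A -> ends_first_in A x g ->
  exists h M, lerw_harmonic A x g h M /\
    h [:: x] = path_weight x g *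
               (kdet p (A :|: [set y in x :: g]%SET) / kdet p A).
Proof.
elim: g A x => [|y g IH] A x aA.
  rewrite ends_first_in_nil => xA.
  exists (fun s => (s == [:: x])%:R), 1; split; last first.
    rewrite eqxx mul1r (_ : A :|: _ = A) ?divff ?kdet_neq0 //.
    by apply/finset.setUidPl/fintype.subsetP => z; rewrite !inE => /eqP ->.
  have ne z s : z != x -> ((z :: s) == [:: x]) = false.
    by move=> zx; rewrite eqseq_cons (negbTE zx).
  split=> //= [s y us sA|y s /ne->//|s]; last by case: (_ == _); rewrite ?normr1 ?normr0.
  have [a [t [-> ax]]] : exists a t, rcons s y = a :: t /\ a != x.
    case: s sA {us} => [|a s] /= /andP[aA' _]; [exists y, [::]|exists a, (rcons s y)];
    by split=> //; apply: contraNneq aA' => ->.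
  rewrite ne // big1 // => z _; have [t' ->] := loop_erase_step_head a t z.
  by rewrite ne // mulr0.
case/ends_first_in_cons=> xA xg vg.
have aB : absorbing p (x |: A) by apply: absorbingS aA => //; exact: finset.subsetUr.
have [h' [M' [[h'a h'b h'c h'M] h'y]]] := IH _ _ aB vg.
have [rho [rhoA rhox rhoH]] := return_prob p_ge0 p_sum1 aA xA.
set D := 1 - _ => DE.
have dA : kdet p A != 0 by exact: kdet_neq0.
have dB : kdet p (x |: A) != 0 by exact: kdet_neq0.
have D0 : D != 0 by rewrite DE mulf_neq0 // invr_eq0.
(* The value wanted at [[:: x]]. It solves [c = p x y * h' [:: y] + (1 - D) * c]: the walk either
   leaves for the last time through [y], or comes back to [x] before [A], which has probability
   [1 - D]. *)
pose c := p x y * h' [:: y] / D.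
(* With past [x :: t], either [A] is reached before [x] and the rest of the erasure is decided by
   [h'], or [x] is revisited first, with probability [rho (last x t)], and the erasure collapses to
   [[:: x]]. *)
pose h s := if s is a :: t then if a == x then
  (if t is _ :: _ then h' t + rho (last x t) * c else c) else 0 else 0.
have hx u z : h (x :: rcons u z) = h' (rcons u z) + rho z * c.
  rewrite /h eqxx; have : last x (rcons u z) = z by rewrite last_rcons.
  by case: (rcons u z) (size_rcons u z) => //= b t _ ->.
have hne a t : a != x -> h (a :: t) = 0 by rewrite /h => /negbTE ->.
(* A walk stopped at [x] contributes nothing to [h'], as the target path avoids [x]. *)
have h'x u : x \notin u -> uniq u -> all [predC A] u -> h' (rcons u x) = 0.
  move=> xu uu uA; rewrite h'a ?setU11 //.
    by case: eqP => // E; move: xg; rewrite -E mem_rcons mem_head.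
  apply/allP => z zu; have zA : z \notin A := allP uA z zu.
  by rewrite !inE negb_or zA andbT; apply: contraNneq xu => <-.
have h'0 z : z != y -> h' [:: z] = 0 by move=> zy; exact: h'c.
exists h, (M' + (1 + \sum_z `|rho z|) * `|c|); split; last first.
  rewrite /h eqxx /c h'y DE.
  have -> : x |: A :|: [set y0 in y :: g]%SET = A :|: [set y0 in [:: x, y & g]]%SET.
    by apply/setP => z; rewrite !inE; do !case: (_ \in _); do !case: (_ == _).
  by rewrite [path_weight x _]/=; field; rewrite dA dB.
split=> // [[|a s] z us sA zA|[|a s] z us sA|[|a s]].
- rewrite [rcons _ _]/= hne; last by apply: contraNneq xA => <-.
  by rewrite eqseq_cons andbF.
- have [ax|ax] := eqVneq a x; last by rewrite hne // eqseq_cons (negbTE ax).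
  move: us sA; rewrite ax rcons_cons => /andP[xs us] /andP[_ sA].
  rewrite hx h'a ?in_setU1 ?zA ?orbT //; last first.
    apply/allP => b bs; have bA : b \notin A := allP sA b bs.
    by rewrite !inE negb_or bA andbT; apply: contraNneq xs => <-.
  by rewrite rhoA // mul0r addr0 eqseq_cons eqxx.
- have [->|zx] := eqVneq z x; last first.
    rewrite [rcons _ _]/= hne // big1 // => b _.
    by have [t ->] := loop_erase_step_head z [::] b; rewrite hne // mulr0.
  have E b : h (loop_erase_step [:: x] b) = h' [:: b] + rho b * c.
    have [<-|xb] := eqVneq x b; last first.
      by rewrite loop_erase_step_cons // -(hx [::]).
    by rewrite loop_erase_step_self (h'x [::]) // rhox mul1r add0r /h eqxx.
  under eq_bigr do rewrite E mulrDr mulrA.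
  rewrite big_split -mulr_suml (bigD1 y) //= [X in _ + X + _]big1 ?addr0; last first.
    by move=> b by'; rewrite h'0 // mulr0.
  have -> : \sum_b p x b * rho b = 1 - D by rewrite /D subKr.
  rewrite /h eqxx mulrBl mul1r [D * c]mulrC /c divfK //.
  by rewrite addrC subrK.
- have [ax|ax] := eqVneq a x; last first.
    rewrite rcons_cons hne // big1 // => b _.
    by have [t ->] := loop_erase_step_head a (rcons s z) b; rewrite hne // mulr0.
  move: us sA; rewrite ax rcons_cons => /andP[xs us] /andP[_ sA].
  have E b : h (loop_erase_step (x :: rcons s z) b) =
      h' (loop_erase_step (rcons s z) b) + rho b * c.
    have [<-|xb] := eqVneq x b; last first.
      by rewrite loop_erase_step_cons // loop_erase_stepE hx.
    by rewrite loop_erase_step_self loop_erase_step_notin // h'x // rhox mul1r add0r /h eqxx.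
  under eq_bigr do rewrite E mulrDr mulrA.
  rewrite big_split -mulr_suml hx.
  have nB b : b \in rcons s z -> b \notin x |: A.
    move=> bs; have bA : b \notin A := allP sA b bs.
    by rewrite !inE negb_or bA andbT; apply: contraNneq xs => <-.
  rewrite (rhoH z) ?nB ?mem_rcons ?mem_head //; congr (_ + _).
  by apply: h'b => //; apply/allP => b /nB.
- by rewrite normr0; apply: le_trans (le_trans (normr_ge0 _) (h'M [::])) _; rewrite lerDl mulr_ge0 // addr_ge0 // sumr_ge0.
- have M0 : 0 <= M' by exact: le_trans (normr_ge0 (h' [::])) (h'M [::]).
  rewrite /h; case: ifP => _; last first.
    by rewrite normr0 addr_ge0 // mulr_ge0 // addr_ge0 // sumr_ge0.
  case: s => [|b s].
    by rewrite -[leLHS]add0r lerD // mulrDl mul1r lerDl mulr_ge0 // sumr_ge0.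
  apply: le_trans (ler_normD _ _) _; rewrite lerD // normrM ler_wpM2r //.
  by rewrite (bigD1 (last x (b :: s))) //= addrCA lerDl addr_ge0 // sumr_ge0.
Qed.

End LoopErasedLaw.

(** * Measurability of discrete functionals of a trajectory *)

Section DiscreteMeasurability.
Local Open Scope classical_set_scope.
Variables (T : Type) (S : set (set T)).
Hypothesis sigS : sigma_algebra setT S.

Lemma sigma_setC A : S A -> S (~` A).
Proof. by case: sigS => _ /(_ A); rewrite setTD. Qed.

Lemma sigma_bigcup_countable (U : countType) (F : U -> set T) :
  (forall u, S (F u)) -> S (\bigcup_u F u).
Proof.
move=> SF; have [S0 _ Sb] := sigS.
have -> : \bigcup_u F u = \bigcup_n (if unpickle n is Some u then F u else set0).
  apply/seteqP; split=> w [].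
    by move=> u _ Fu; exists (pickle u); rewrite ?pickleK.
  by move=> n _; case E: (unpickle n) => [u|//] Fu; exists u.
by apply: Sb => n; case: (unpickle n).
Qed.

Lemma sigma_setT : S setT.
Proof. by rewrite -setC0; apply: sigma_setC; case: sigS. Qed.

Lemma sigma_bigcap_countable (U : countType) (F : U -> set T) :
  (forall u, S (F u)) -> S (\bigcap_u F u).
Proof.
move=> SF; rewrite -[X in S X]setCK setC_bigcap; apply: sigma_setC.
by apply: sigma_bigcup_countable => u; exact: sigma_setC.
Qed.

Lemma sigma_setU A B : S A -> S B -> S (A `|` B).
Proof.
move=> SA SB.
have -> : A `|` B = \bigcup_(b : bool) (if b then A else B).
  apply/seteqP; split=> w; first by case=> ?; [exists true|exists false].
  by case; case=> _ ?; [left|right].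
by apply: sigma_bigcup_countable; case.
Qed.

Lemma sigma_setI A B : S A -> S B -> S (A `&` B).
Proof.
move=> SA SB; rewrite -[X in S X]setCK setCI.
by apply: sigma_setC; apply: sigma_setU; exact: sigma_setC.
Qed.

(** Measurability into a discrete target. [S] is kept abstract since it stands both for all
    measurable sets and for the sigma-algebra of a single walk, the latter being what independence
    requires. *)
Definition determined (U : Type) (f : T -> U) := forall Q : set U, S (f @^-1` Q).

Lemma determined_countable (U : countType) (f : T -> U) :
  (forall u, S [set w | f w = u]) -> determined f.
Proof.
move=> Sf Q; have [S0 _ _] := sigS.
have -> : f @^-1` Q = \bigcup_u (if u \in Q then [set w | f w = u] else set0).
  apply/seteqP; split=> w.
    by move=> Qw; exists (f w) => //; rewrite mem_set.
  by case=> u _; case: ifP => // uQ /= ->; exact: set_mem.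
by apply: sigma_bigcup_countable => u; case: ifP.
Qed.

Lemma determined_cst (U : Type) (u : U) : determined (fun _ : T => u).
Proof.
move=> Q; have [Qu|Qu] := pselect (Q u).
  have -> : (fun _ : T => u) @^-1` Q = setT by apply/seteqP; split.
  exact: sigma_setT.
have -> : (fun _ : T => u) @^-1` Q = set0 by apply/seteqP; split.
by case: sigS.
Qed.

Lemma determined_bind (U : countType) (W : Type) (f : T -> U) (g : U -> T -> W) :
  determined f -> (forall u, determined (g u)) -> determined (fun w => g (f w) w).
Proof.
move=> df dg Q.
have -> : (fun w => g (f w) w) @^-1` Q =
    \bigcup_u (f @^-1` [set u] `&` g u @^-1` Q).
  apply/seteqP; split=> w; first by move=> Qw; exists (f w).
  by case=> u _ /= [-> ].
by apply: sigma_bigcup_countable => u; apply: sigma_setI; [exact: df|exact: dg].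
Qed.

Lemma determined_comp (U : countType) (W : Type) (f : T -> U) (g : U -> W) :
  determined f -> determined (g \o f).
Proof. by move=> df Q; exact: (df (g @^-1` Q)). Qed.

Variables (V : finType) (X : nat -> T -> V).
Hypothesis dX : forall k y, S [set w | X k w = y].

Lemma determined_prefix k : determined (fun w => mkseq (X ^~ w) k).
Proof.
elim: k => [|k IH]; first exact: determined_cst.
have -> : (fun w => mkseq (X ^~ w) k.+1) =
    (fun w => rcons (mkseq (X ^~ w) k) (X k w)).
  by apply/funext => w; rewrite mkseq_rcons.
apply: (@determined_bind _ _ _ (fun s w => rcons s (X k w)) IH) => s.
apply: (@determined_comp _ _ (X k) (rcons s)).
exact: determined_countable.
Qed.

Lemma determined_branch (A : {set V}) : determined (fun w => branch A (X ^~ w)).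
Proof.
apply: determined_countable => g.
pose hit k := [set s : seq V | has (mem A) s && ~~ has (mem A) (take k s)].
pose E k := (fun w => mkseq (X ^~ w) k.+1) @^-1`
  [set s | hit k s /\ loop_erasure s = g].
pose N := \bigcap_k ((X k) @^-1` [set x | x \notin A]).
have hitP k w : hit k (mkseq (X ^~ w) k.+1) <->
    (X k w \in A /\ forall j, (j < k)%N -> X j w \notin A).
  rewrite /hit mkseq_rcons /= has_rcons -cats1 take_size_cat ?size_mkseq //.
  split=> [/andP[/orP[kA|/[swap]/negP//] /hasPn nA]|[kA nA]].
    by split=> // j jk; apply: (nA (X j w)); apply/mapP; exists j; rewrite ?mem_iota.
  apply/andP; split; first by apply/orP; left.
  apply/hasPn => x /mapP[j]; rewrite mem_iota => /andP[_ jk] ->.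
  exact: nA.
(* Split according to the hitting time; [N] is the event that [A] is never hit, where the branch has
   its default value [[::]]. *)
have -> : [set w | branch A (X ^~ w) = g] =
    (\bigcup_k E k) `|` (N `&` [set w | g = [::]]).
  apply/seteqP; split=> w /=.
    have [hA|nA] := pselect (exists k, X k w \in A).
      have [k kA kmin] := first_hit hA.
      rewrite /branch (stopped_path_first kA kmin) => gE; left; exists k => //.
      by split=> //; exact/hitP.
    rewrite /branch /stopped_path; case: pselect => // _ gE; right; split=> //.
    by move=> k _ /=; apply/negP => kA; apply: nA; exists k.
  case=> [[k _ [/hitP[kA kmin] <-]]|[Nw ->]].
    by rewrite /branch (stopped_path_first kA kmin).
  rewrite /branch /stopped_path; case: pselect => // [[k kA]].
  by move: (Nw k Logic.I); rewrite /= kA.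
apply: sigma_setU; first by apply: sigma_bigcup_countable => k; exact: determined_prefix.
apply: sigma_setI; last exact: (determined_cst g [set g | g = [::]]).
by apply: sigma_bigcap_countable => k; exact: determined_countable.
Qed.

End DiscreteMeasurability.

(** * Real-valued probabilities and finite unions *)

Section FiniteAdditivity.
Local Open Scope classical_set_scope.
Variables (R : realType) (d : measure_display) (T : measurableType d).
Variable P : probability T R.
Implicit Types (E F : set T).

Definition pr E : R := fine (P E).

Lemma prE E : measurable E -> P E = (pr E)%:E.
Proof. by move=> mE; rewrite fineK ?fin_num_measure. Qed.

Lemma pr_ge0 E : 0 <= pr E.
Proof. exact: fine_ge0. Qed.

Lemma pr0 : pr set0 = 0.
Proof. by rewrite /pr measure0. Qed.

Lemma prT : pr setT = 1.
Proof. by rewrite /pr probability_setT. Qed.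

Lemma pr_le E F : measurable E -> measurable F -> E `<=` F -> pr E <= pr F.
Proof.
by move=> mE mF EF; rewrite -lee_fin -!prE //; apply: le_measure; rewrite ?inE.
Qed.

Lemma pr_le1 E : measurable E -> pr E <= 1.
Proof. by move=> mE; rewrite -lee_fin -prE // probability_le1. Qed.

Lemma fsbig_finType (I : finType) (Q : {pred I}) (f : I -> \bar R) :
  (\sum_(i \in [set` Q]) f i = \sum_(i | Q i) f i)%E.
Proof. by rewrite -(@bigfs _ _ _ _ (index_enum I)) ?index_enum_uniq // => i _; rewrite mem_index_enum. Qed.

Lemma pr_bigcup (I : finType) (Q : {pred I}) (F : I -> set T) :
  (forall i, Q i -> measurable (F i)) ->
  (forall i j w, Q i -> Q j -> F i w -> F j w -> i = j) ->
  pr [set w | exists2 i, Q i & F i w] = \sum_(i | Q i) pr (F i).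
Proof.
move=> mF tF; rewrite (_ : [set w | _] = \bigcup_(i in [set` Q]) F i).
  rewrite /pr measure_fin_bigcup //.
  - rewrite fsbig_finType (eq_bigr (fun i => (pr (F i))%:E)) => [|i Qi]; last exact/prE/mF.
    by rewrite sumEFin.
  - by move=> i j Qi Qj [w [Fi Fj]]; exact: (tF i j w).
by apply/seteqP; split=> w [i Qi Fi]; exists i.
Qed.

Lemma pr_union_le (I : finType) (Q : {pred I}) (F : I -> set T) E :
  measurable E -> (forall i, Q i -> measurable (F i)) ->
  (forall w, E w -> exists2 i, Q i & F i w) ->
  pr E <= \sum_(i | Q i) pr (F i).
Proof.
move=> mE mF EF; rewrite -lee_fin -prE //.
rewrite -sumEFin (eq_bigr (fun i => P (F i))) => [|i Qi]; last by rewrite prE //; exact: mF.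
rewrite -fsbig_finType; exact: content_sub_fsum.
Qed.

Lemma pr_split E F : measurable E -> measurable F ->
  pr E = pr (E `&` F) + pr (E `&` ~` F).
Proof.
move=> mE mF; have mI : measurable (E `&` F) by exact: measurableI.
have mC : measurable (E `&` ~` F) by apply: measurableI => //; exact: measurableC.
apply: EFin_inj; rewrite EFinD -!prE // -setDE addeC; exact: measureDI.
Qed.

Lemma pr_setC F : measurable F -> pr (~` F) = 1 - pr F.
Proof.
by move=> mF; apply: EFin_inj; rewrite EFinB -!prE ?probability_setC //; exact: measurableC.
Qed.

Lemma pr_setI1 E F : measurable E -> measurable F -> pr F = 1 ->
  pr E = pr (E `&` F).
Proof.
move=> mE mF F1; rewrite (pr_split mE mF) -[RHS]addr0; congr (_ + _).
apply/eqP; rewrite eq_le pr_ge0 andbT -[leRHS](subrr 1) -{2}F1 -pr_setC //.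
have mC := measurableC mF.
by apply: pr_le => //; exact: measurableI.
Qed.

End FiniteAdditivity.

(** * From the law of finite prefixes to the law of a branch *)

Section WalkLaw.
Local Open Scope classical_set_scope.
Variables (R : realType) (V : finType) (e : rel V).
Hypothesis e_out : forall x, exists y, e x y.
Notation p := (step_prob e R).

Lemma step_prob_ge0 x y : 0 <= p x y.
Proof. by rewrite /step_prob; case: ifP => // _; rewrite invr_ge0 ler0n. Qed.

Lemma step_prob_sum1 x : \sum_y p x y = 1.
Proof.
rewrite /step_prob -big_mkcond sumr_const /=.
have -> : #|(fun y => e x y)| = #|[set z | e x z]%SET|.
  by apply: eq_card => y; rewrite inE.
rewrite -[RHS](@mulfV _ #|[set z | e x z]%SET|%:R) ?mulr_natl //.
rewrite pnatr_eq0 -lt0n; apply/card_gt0P; have [y exy] := e_out x.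
by exists y; rewrite inE.
Qed.

(** The conditional mean of [F] after [k] more steps of the walk, given the past [s]; [x] is only
    the default of [last]. *)
Fixpoint avg (x : V) k (F : seq V -> R) (s : seq V) : R :=
  if k is k'.+1 then \sum_y p (last x s) y * avg x k' F (rcons s y) else F s.

Lemma avg_dist x k F G N M s :
  (forall s, `|F s - G s| <= M * N s) ->
  `|avg x k F s - avg x k G s| <= M * avg x k N s.
Proof.
move=> FG; elim: k s => //= k IH s.
rewrite -sumrB mulr_sumr; apply: le_trans (ler_norm_sum _ _ _) _.
apply: ler_sum => y _; rewrite -mulrBr normrM (ger0_norm (step_prob_ge0 _ _)).
by rewrite mulrCA ler_wpM2l // step_prob_ge0.
Qed.

Lemma avg_harmonic x k F u a :
  (forall u a, F (rcons u a) = \sum_y p a y * F (rcons (rcons u a) y)) ->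
  avg x k F (rcons u a) = F (rcons u a).
Proof.
move=> FH; elim: k u a => //= k IH u a; rewrite last_rcons [RHS]FH.
by apply: eq_bigr => y _; rewrite IH.
Qed.

Lemma avg_avoid x k (A : {set V}) u a :
  avg x k (fun s => (~~ has (mem A) s)%:R) (rcons u a) =
  (~~ has (mem A) u)%:R * surv p A k a.
Proof.
elim: k u a => [|k IH] u a /=.
  rewrite has_rcons negb_or /=; case: (a \in A); first by rewrite mulr0.
  by rewrite mulr1.
rewrite last_rcons; under eq_bigr do rewrite IH has_rcons negb_or /=.
case: (a \in A) => /=; first by rewrite big1 ?mulr0 // => y _; rewrite mul0r mulr0.
by rewrite mulr_sumr; apply: eq_bigr => y _; rewrite mulrCA.
Qed.

(** The path frozen at its first visit to [A]. Composing with it extends a function harmonic until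
    absorption to one that is harmonic at all times. *)
Definition cut (A : {set V}) (s : seq V) := take (find (mem A) s).+1 s.

Lemma has_split (A : {set V}) s : has (mem A) s ->
  exists u y t, [/\ s = rcons u y ++ t, ~~ has (mem A) u & y \in A].
Proof.
elim: s => //= a s IH; have [aA _|aA /= /IH[u [y [t [-> uA yA]]]]] := boolP (a \in A).
  by exists [::], a, s.
by exists (a :: u), y, t; split=> //=; rewrite negb_or aA.
Qed.

Lemma cut_first (A : {set V}) u y t : ~~ has (mem A) u -> y \in A ->
  cut A (rcons u y ++ t) = rcons u y.
Proof.
move=> uA yA; rewrite /cut -cats1 -catA find_cat (negbTE uA) /= yA addn0.
by rewrite -cat1s catA take_size_cat // size_cat addn1.
Qed.

Lemma cut_avoid (A : {set V}) s : ~~ has (mem A) s -> cut A s = s.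
Proof. by move=> sA; rewrite /cut hasNfind // take_oversize. Qed.

Lemma cut_avoid_rcons (A : {set V}) s y : ~~ has (mem A) s ->
  cut A (rcons s y) = rcons s y.
Proof.
move=> sA; have [yA|yA] := boolP (y \in A).
  by have := @cut_first A s y [::] sA yA; rewrite cats0.
by rewrite cut_avoid // has_rcons /= negb_or yA.
Qed.

Lemma all_notin_has (A : {set V}) s : ~~ has (mem A) s -> all [predC A] s.
Proof. by rewrite -all_predC. Qed.

Lemma all_loop_erasure (A : {set V}) s : ~~ has (mem A) s ->
  all [predC A] (loop_erasure s).
Proof.
move/all_notin_has/allP => sA; apply/allP => z /mem_loop_erasure; exact: sA.
Qed.

Lemma branch_prefix (A : {set V}) w k : has (mem A) (mkseq w k) ->
  branch A w = loop_erasure (cut A (mkseq w k)).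
Proof.
move=> hA; rewrite /branch; congr loop_erasure.
have hi : (find (mem A) (mkseq w k) < k)%N by rewrite -[ltnRHS](size_mkseq w) -has_find.
have iA := nth_find (w 0%N) hA; rewrite nth_mkseq // in iA.
rewrite (stopped_path_first iA) => [|j ji]; last first.
  have := before_find (w 0%N) ji; rewrite nth_mkseq ?(ltn_trans ji) // => jA.
  by apply/negP => jA'; move: jA; rewrite /= jA'.
by rewrite /cut -map_take take_iota (minn_idPl hi).
Qed.

Variables (d : measure_display) (Omega : measurableType d).
Variables (P : probability Omega R) (x : V) (X : nat -> Omega -> V).
Hypothesis X_srw : srw e P x X.

Let mX k y : measurable [set w | X k w = y]. Proof. by case: X_srw. Qed.

Lemma measurable_prefix k (Q : set (seq V)) :
  measurable [set w | Q (mkseq (X ^~ w) k)].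
Proof. exact: (determined_prefix (sigma_algebra_measurable Omega) mX). Qed.

Lemma measurable_branch A (Q : set (seq V)) :
  measurable [set w | Q (branch A (X ^~ w))].
Proof. exact: (determined_branch (sigma_algebra_measurable Omega) mX). Qed.

Lemma pr_prefix_step q k :
  pr P [set w | mkseq (X ^~ w) k.+2 = mkseq q k.+2] =
  pr P [set w | mkseq (X ^~ w) k.+1 = mkseq q k.+1] * p (q k) (q k.+1).
Proof.
have fE j : follows X q j = [set w | mkseq (X ^~ w) j.+1 = mkseq q j.+1].
  apply/seteqP; split=> w /= H; first by apply/eq_in_map => i; rewrite mem_iota ltnS; exact: H.
  move=> i ij; have := congr1 (nth (q 0%N) ^~ i) H.
  by rewrite !nth_mkseq.
have [_ _ law] := X_srw; have := law q k; rewrite !fE !prE; try exact: (measurable_prefix _ [set s | s = _]).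
by rewrite -EFinM; exact: EFin_inj.
Qed.

Lemma pr_prefix_avg j k u a (Q : pred (seq V)) : size u = j ->
  pr P [set w | mkseq (X ^~ w) j.+1 = rcons u a /\ Q (mkseq (X ^~ w) (j + k).+1)] =
  pr P [set w | mkseq (X ^~ w) j.+1 = rcons u a] *
    avg x k (fun s => (Q s)%:R) (rcons u a).
Proof.
elim: k j u a => [|k IH] j u a sj.
  rewrite addn0 /=; have [Qu|Qu] := boolP (Q (rcons u a)); rewrite ?mulr1 ?mulr0.
    by congr pr; apply/seteqP; split=> w /=; [case|move=> ->].
  rewrite -[RHS](pr0 P); congr pr; apply/seteqP; split=> w //=.
  by case=> ->; rewrite (negbTE Qu).
rewrite -(addSnnS j) /= last_rcons mulr_sumr.
have Ey y : pr P [set w | mkseq (X ^~ w) j.+2 = rcons (rcons u a) y] =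
    pr P [set w | mkseq (X ^~ w) j.+1 = rcons u a] * p a y.
  have := pr_prefix_step (nth y (rcons (rcons u a) y)) j.
  have -> : mkseq (nth y (rcons (rcons u a) y)) j.+2 = rcons (rcons u a) y.
    by rewrite -[X in mkseq _ X](_ : size (rcons (rcons u a) y) = _) ?mkseq_nth // !size_rcons sj.
  have -> : mkseq (nth y (rcons (rcons u a) y)) j.+1 = rcons u a.
    apply: (@eq_from_nth _ y) => [|i]; rewrite size_mkseq ?size_rcons ?sj // => ij.
    by rewrite nth_mkseq // nth_rcons size_rcons sj ij.
  have -> : nth y (rcons (rcons u a) y) j = a.
    by rewrite nth_rcons size_rcons sj ltnSn nth_rcons sj ltnn eqxx.
  by have -> : nth y (rcons (rcons u a) y) j.+1 = y
    by rewrite nth_rcons size_rcons sj ltnn eqxx.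
transitivity (\sum_y pr P [set w | mkseq (X ^~ w) j.+2 = rcons (rcons u a) y /\
    Q (mkseq (X ^~ w) (j.+1 + k).+1)]); last first.
  by apply: eq_bigr => y _; rewrite IH ?size_rcons ?sj // Ey mulrA.
rewrite -(@pr_bigcup _ _ _ P _ xpredT) => [|y _|y z w _ _ [Ey' _] [Ez _]].
- congr pr; apply/seteqP; split=> w /=.
    by case=> E Qw; exists (X j.+1 w) => //; rewrite mkseq_rcons E.
  by case=> y _ []; rewrite mkseq_rcons => /rcons_inj[-> _].
- apply: measurableI; first exact: (measurable_prefix _ [set s | s = _]).
  exact: (measurable_prefix _ [set s | Q s]).
- by move: Ey'; rewrite Ez => /rcons_inj[].
Qed.

Lemma pr_start : pr P [set w | X 0%N w = x] = 1.
Proof. by case: X_srw => _ P1 _; rewrite /pr P1. Qed.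

Lemma pr_prefix k (Q : pred (seq V)) :
  pr P [set w | Q (mkseq (X ^~ w) k.+1)] = avg x k (fun s => (Q s)%:R) [:: x].
Proof.
rewrite (pr_setI1 _ (mX 0%N x) pr_start); last exact: (measurable_prefix _ [set s | Q s]).
have := @pr_prefix_avg 0 k [::] x Q erefl; rewrite add0n.
rewrite (_ : [set w | mkseq (X ^~ w) 1 = rcons [::] x] = [set w | X 0%N w = x]); last first.
  by apply/seteqP; split=> w /=; [case|move=> E; rewrite /mkseq /= E].
rewrite pr_start mul1r => <-; congr pr; apply/seteqP; split=> w /=.
  by case=> ? E; split=> //; rewrite /mkseq /= E.
by case=> [[E]].
Qed.

Lemma pr_avoid (A : {set V}) k :
  pr P [set w | ~~ has (mem A) (mkseq (X ^~ w) k.+1)] = surv p A k x.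
Proof.
by rewrite (pr_prefix k (fun s => ~~ has (mem A) s)) (avg_avoid _ _ _ [::]) mul1r.
Qed.

Lemma pr_never (A : {set V}) : absorbing p A ->
  pr P [set w | forall k, X k w \notin A] = 0.
Proof.
move=> aA; apply/eqP; rewrite eq_le pr_ge0 andbT.
apply: (surv_lim step_prob_ge0 step_prob_sum1 (M := 1) (x := x) aA) => k.
rewrite mul1r -pr_avoid; apply: pr_le; last 1 first.
- move=> w nA; suff: ~~ has (mem A) (mkseq (X ^~ w) k.+1) by [].
  by apply/hasPn => _ /mapP[i _ ->]; exact: nA.
- rewrite (_ : [set w | _] = \bigcap_k [set w | X k w \notin A]); last first.
    by apply/seteqP; split=> w nA; [move=> i _; exact: nA|move=> i; exact: (nA i Logic.I)].
  apply: bigcapT_measurable => i.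
  exact: (determined_countable (sigma_algebra_measurable Omega) (mX i) [set a | a \notin A]).
- exact: (measurable_prefix _ [set s | ~~ has (mem A) s]).
Qed.

(** [H] is a martingale along the walk, with initial value [h [:: x]]. Once [A] has been hit it
    equals the indicator that the branch is [x :: g], and before that it is bounded by [M]; the
    horizon is then sent to infinity. *)
Lemma pr_branch (A : {set V}) g : absorbing p A -> x \notin A ->
  ends_first_in A x g ->
  pr P [set w | branch A (X ^~ w) = x :: g] =
  path_weight p x g * (kdet p (A :|: [set y in x :: g]%SET) / kdet p A).
Proof.
move=> aA xA vg.
have [h [M [[ha hb hc hM] hx]]] :=
  lerw_harmonic_exists step_prob_ge0 step_prob_sum1 aA vg.
rewrite -hx.
pose H s := h (loop_erasure (cut A s)).
have HH u a : H (rcons u a) = \sum_y p a y * H (rcons (rcons u a) y).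
  have [/has_split[u' [y [t [-> u'A yA]]]]|nA] := boolP (has (mem A) (rcons u a)).
    under eq_bigr do rewrite /H -[rcons (_ ++ _) _]cats1 -catA !cut_first //.
    by rewrite -mulr_suml step_prob_sum1 mul1r /H cut_first.
  rewrite /H cut_avoid //; under eq_bigr do rewrite cut_avoid_rcons // loop_erasure_rcons.
  have := uniq_loop_erasure (rcons u a); have := all_loop_erasure nA.
  by rewrite !loop_erasure_rcons loop_erase_stepE => ? ?; rewrite hb.
have Hx k : avg x k H [:: x] = h [:: x].
  by rewrite (@avg_harmonic x k H [::] x HH) /H cut_avoid //= orbF.
pose Q s := has (mem A) s && (loop_erasure (cut A s) == x :: g).
have QH s : `|(Q s)%:R - H s| <= M * (~~ has (mem A) s)%:R.
  rewrite /Q; have [/has_split[u [y [t [-> uA yA]]]]|sA] /= := boolP (has _ _).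
    rewrite /H cut_first // loop_erasure_rcons loop_erase_step_notin; last first.
      by apply/negP => /mem_loop_erasure yu; case/hasP: uA; exists y.
    by rewrite ha ?uniq_loop_erasure ?all_loop_erasure // subrr normr0 mulr0.
  by rewrite sub0r normrN mulr1 hM.
(* Walks still alive at time [k] cost [M] in the mean of [H] and 1 in the probability of the
   branch. *)
have dist k : `|pr P [set w | branch A (X ^~ w) = x :: g] - h [:: x]|
    <= (M + 1) * surv p A k x.
  have mB : measurable [set w | branch A (X ^~ w) = x :: g].
    exact: (measurable_branch A [set s | s = _]).
  have mQ : measurable [set w | Q (mkseq (X ^~ w) k.+1)].
    exact: (measurable_prefix _ [set s | Q s]).
  have mN : measurable [set w | ~~ has (mem A) (mkseq (X ^~ w) k.+1)].
    exact: (measurable_prefix _ [set s | ~~ has (mem A) s]).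
  have le1 : pr P [set w | Q (mkseq (X ^~ w) k.+1)] <=
      pr P [set w | branch A (X ^~ w) = x :: g].
    by apply: pr_le => // w /= /andP[hA /eqP <-]; exact: branch_prefix.
  have le2 : pr P [set w | branch A (X ^~ w) = x :: g] <=
      pr P [set w | Q (mkseq (X ^~ w) k.+1)] + surv p A k x.
    rewrite -pr_avoid (pr_split P mB mN) addrC lerD //; apply: pr_le => //.
    - by apply: measurableI => //; exact: measurableC.
    - move=> w [Bw nnA]; suff: Q (mkseq (X ^~ w) k.+1) by [].
      have {}Bw : branch A (X ^~ w) = x :: g := Bw.
      have hA : has (mem A) (mkseq (X ^~ w) k.+1) by apply: contrapT => /negP.
      by rewrite /Q hA -branch_prefix // Bw eqxx.
    - exact: measurableI.
  have := @avg_dist x k _ H _ M [:: x] QH.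
  rewrite -(pr_prefix k Q) Hx (avg_avoid x k A [::]) mul1r => le3.
  apply: le_trans (ler_distD (pr P [set w | Q (mkseq (X ^~ w) k.+1)]) _ _) _.
  rewrite mulrDl mul1r addrC lerD //.
  by rewrite ger0_norm ?subr_ge0 // lerBlDl.
apply/eqP; rewrite -subr_eq0 -normr_le0.
exact: (surv_lim step_prob_ge0 step_prob_sum1 aA dist).
Qed.

End WalkLaw.

(** * The law of Wilson's tree *)

Section ParentFunctions.
Variables (V : finType) (r : V).
Implicit Types (pi : {ffun V -> V}) (t : {set V}) (o : seq V).
Implicit Types (W : V -> nat -> V) (T : subgraph V).

Definition parent_walk pi (x : V) (k : nat) : V := iter k pi x.

(** Spanning trees oriented towards [r], with [r] its own parent so that iterates are total.
    Adjacency is imposed separately, by [step_edges]. *)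
Definition rooted pi := pi r = r /\ forall x, exists k, iter k pi x = r.

(** The set [t] grows by the branches of [pi], not by those of [W]. Each test therefore involves a
    single walk and a set fixed in advance, which makes independence applicable. *)
Fixpoint agrees pi t o W : bool :=
  if o is x :: o' then
    if x \in t then agrees pi t o' W
    else (branch t (W x) == branch t (parent_walk pi x)) &&
         agrees pi (t :|: [set y in branch t (parent_walk pi x)]%SET) o' W
  else true.

Lemma branch_parent pi t x : rooted pi -> r \in t ->
  exists g, [/\ branch t (parent_walk pi x) = x :: g, ends_first_in t x g
              & fpath pi x g].
Proof.
move=> [_ /(_ x)[k kr]] rt.
have hA : exists k, parent_walk pi x k \in t by exists k; rewrite /parent_walk kr.
have [|g [E vg pg _]] := @branch_ends _ (frel pi) t _ hA; last by exists g.
by move=> j; rewrite /= eqxx.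
Qed.

Lemma agrees_wilson pi T o W : agrees pi T.1 o W ->
  foldl (wilson_step W) T o = foldl (wilson_step (parent_walk pi)) T o.
Proof.
elim: o T => //= x o IH T; rewrite /wilson_step; case: ifP => xT; first exact: IH.
by case/andP=> /eqP -> ag; apply: IH.
Qed.

Lemma fpath_belast (f f' : V -> V) x g : {in belast x g, f =1 f'} ->
  fpath f x g -> fpath f' x g.
Proof.
elim: g x => //= y g IH x ff' /andP[fx fg]; rewrite -ff' ?mem_head // fx /=.
by apply: IH fg => z zg; apply: ff'; rewrite inE zg orbT.
Qed.

Lemma path_edges_fpath (f : V -> V) x g : fpath f x g ->
  path_edges (x :: g) = [set [set y; f y] | y in [set z in belast x g]]%SET.
Proof.
move=> fg; rewrite /path_edges.
have -> : zip (x :: g) (behead (x :: g)) = [seq (y, f y) | y <- belast x g].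
  elim: g x fg => //= y g IH x /andP[/eqP -> fg].
  by congr (_ :: _); exact: IH.
apply/setP => E; apply/imsetP/imsetP => -[].
  by move=> z /mapP[y yg ->] ->; exists y; rewrite ?inE.
by move=> y; rewrite inE => yg ->; exists (y, f y) => //; apply/mapP; exists y.
Qed.

Definition parent_tree pi : subgraph V :=
  ([set: V], [set [set y; pi y] | y in ~: [set r]])%SET.

Lemma wilson_parent pi o : rooted pi -> (forall y, y != r -> y \in o) ->
  wilson (parent_walk pi) r o = parent_tree pi.
Proof.
move=> gpi; rewrite /wilson => ro.
set T : subgraph V := ([set r]%SET, finset.set0).
have rT : r \in T.1 by rewrite inE.
(* [TE] and [To] are the invariants of the run: the edges are the parent edges of the vertices
   reached, and every missing vertex is still to come in the order. *)
have TE : T.2 = [set [set y; pi y] | y in T.1 :\ r]%SET.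
  by rewrite /= finset.setDv imset0.
have To y : y \notin T.1 -> y \in o by rewrite inE; exact: ro.
elim: o T rT TE To {ro} => [|x o IH] T rT TE To /=.
  have T1 : T.1 = [set: V]%SET.
    by apply/setP => y; rewrite inE; apply/negPn/negP => /To.
  by case: T T1 TE {rT To} => T1 T2 /= -> ->; rewrite finset.setTD.
rewrite /wilson_step; case: ifP => xT.
  apply: IH => // y yT; have := To y yT; rewrite inE => /orP[/eqP yx|//].
  by rewrite yx xT in yT.
have [g [E vg pg]] := branch_parent x gpi rT.
apply: IH; rewrite E /add_path /=.
- by rewrite inE rT.
- rewrite (path_edges_fpath pg) TE -imsetU.
  rewrite (_ : _ :|: _ = (T.1 :|: [set y in x :: g]) :\ r)%SET //; apply/setP => y.
  have /setP/(_ y) := ends_first_in_out vg; rewrite !inE => <-.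
  by have [->|_] := eqVneq y r; rewrite ?rT //=; case: (y \in T.1) => //=; rewrite ?orbF.
move=> y; rewrite !inE negb_or negb_or => /andP[yT /andP[yx _]].
by have := To y yT; rewrite inE (negbTE yx).
Qed.

(** A run reveals the parent of each vertex when it enters the tree, as its successor on the branch
    that brings it in. *)
Lemma agrees_inj pi pi' t o W : rooted pi -> rooted pi' -> r \in t ->
  agrees pi t o W -> agrees pi' t o W ->
  forall y, y \notin t -> y \in o -> pi y = pi' y.
Proof.
move=> gpi gpi'; elim: o t => //= x o IH t rt; have [xt|xt] := ifP.
  move=> h h' y yt; rewrite inE => /orP[/eqP yx|]; last exact: (IH t).
  by rewrite yx xt in yt.
move=> /andP[/eqP WE h] /andP[/eqP WE' h'] y yt yo.
have [g [E vg pg]] := branch_parent x gpi rt.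
have [g' [E' vg' pg']] := branch_parent x gpi' rt.
have gg : g = g' by move: E'; rewrite -WE' WE E => -[].
subst g'; rewrite E in h; rewrite E' in h'.
have [yg|yg] := boolP (y \in x :: g).
  have : y \in belast x g.
    by have /setP/(_ y) := ends_first_in_out vg; rewrite !inE -in_cons yg yt => <-.
  elim: g x pg pg' {E E' vg vg' h h' WE WE' xt yo yg IH} => //= z g IH x.
  move=> /andP[/eqP xz pg] /andP[/eqP xz' pg']; rewrite inE => /orP[/eqP ->|].
    by rewrite xz xz'.
  exact: IH.
apply: (IH _ _ h h'); first by rewrite inE rt.
  by rewrite !inE -in_cons negb_or yt.
by move: yo yg; rewrite !inE negb_or => /orP[->//|-> _].
Qed.

Lemma iter_last_reach (f : V -> V) x g y : fpath f x g ->
  (exists k, iter k f (last x g) = r) -> y \in x :: g ->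
  exists k, iter k f y = r.
Proof.
elim: g x y => /= [|z g IH] x y; first by move=> _ H; rewrite inE => /eqP ->.
move=> /andP[/eqP xz pg] H; rewrite inE => /orP[/eqP ->|]; last exact: IH.
have [k kr] := IH z z pg H (mem_head _ _).
by exists k.+1; rewrite iterSr xz.
Qed.

(** The parent function is built along the run, changing at each turn only the vertices just added.
    Agreement on [t] is part of the conclusion so that later turns preserve the branches already
    recorded. *)
Lemma agrees_exists_from W o : (forall x, x != r -> W x 0%N = x) ->
  (forall x, x != r -> exists k, W x k = r) ->
  forall t pi, r \in t -> pi r = r -> (forall y, y \in t -> pi y \in t) ->
    (forall y, y \in t -> exists k, iter k pi y = r) ->
    (forall y, y \notin t -> y \in o) ->
  exists pi', [/\ rooted pi', {in t, pi' =1 pi} & agrees pi' t o W].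
Proof.
move=> W0 Wr; elim: o => [|x o IH] t pi rt pir pit reach to.
  have tT y : y \in t by apply/negPn/negP => /to.
  by exists pi; split=> //; split=> // y; exact: reach.
have [xt|xt] := boolP (x \in t).
  have [y yt|pi' [? ? ?]] := IH t pi rt pir pit reach.
    have := to y yt; rewrite inE => /orP[/eqP yx|//].
    by rewrite yx xt in yt.
  by exists pi'; rewrite /= xt.
have xr : x != r by apply: contraNneq xt => ->.
have hA : exists k, W x k \in t by have [k kr] := Wr x xr; exists k; rewrite kr.
have [g []] := branch_ends_first hA; rewrite W0 // => E vg _.
have /and3P[ug aA lt] := vg.
have nt y : y \in belast x g -> y \notin t := allP aA y.
have gE y : y \in x :: g -> (y \in belast x g) || (y \in t).
  by move=> yg; have /setP/(_ y) := ends_first_in_out vg;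
    rewrite !inE -in_cons yg andbT => <-; case: (y \in t).
(* [next] is cyclic, but it is used only off the last vertex, where it is the successor on the
   branch. *)
pose pi1 := [ffun y => if y \in belast x g then next (x :: g) y else pi y].
have pi1t y : y \in t -> pi1 y = pi y.
  by move=> yt; rewrite ffunE; case: ifP => // /nt; rewrite yt.
have pg : fpath pi1 x g.
  apply: (@fpath_belast (next (x :: g))) => [y yg|]; first by rewrite ffunE yg.
  by have := cycle_next ug; rewrite /= rcons_path => /andP[].
have it k y : y \in t -> iter k pi1 y = iter k pi y /\ iter k pi y \in t.
  move=> yt; elim: k => //= k [-> kt]; rewrite pi1t //; split=> //.
  exact: pit.
have reach1 y : y \in t -> exists k, iter k pi1 y = r.
  by move=> yt; have [k kr] := reach y yt; exists k; rewrite (it k y yt).1.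
have [||y||y|pi' [gpi' pi'E ag]] := IH (t :|: [set y in x :: g]%SET) pi1.
- by rewrite inE rt.
- by rewrite pi1t.
- rewrite finset.in_setU => yt; have {yt}: (y \in t) || (y \in belast x g).
    by case/orP: yt => [->//|]; rewrite inE orbC; exact: gE.
  case/orP=> [yt|yg]; first by rewrite inE pi1t // pit.
  by rewrite ffunE yg !inE -in_cons mem_next mem_belast ?orbT.
- move=> y; rewrite finset.in_setU [y \in [set z in _]%SET]inE => /orP[/reach1//|].
  by apply: iter_last_reach => //; exact: reach1.
- rewrite !inE !negb_or => /andP[yt /andP[yx _]].
  by have := to y yt; rewrite inE (negbTE yx).
have pg' : fpath pi' x g.
  apply: fpath_belast pg => y yg; rewrite pi'E // !inE -in_cons mem_belast ?orbT //.
exists pi'; split=> //; first by move=> y yt; rewrite pi'E ?inE ?yt // pi1t.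
by rewrite /= (negbTE xt) (branch_traject vg pg') E eqxx.
Qed.

Lemma agrees_exists W o : (forall x, x != r -> W x 0%N = x) ->
  (forall x, x != r -> exists k, W x k = r) ->
  (forall y, y != r -> y \in o) ->
  exists2 pi, rooted pi & agrees pi [set r]%SET o W.
Proof.
move=> W0 Wr ro.
have [|||||pi [gpi _ ag]] := @agrees_exists_from W o W0 Wr [set r]%SET [ffun=> r].
- by rewrite inE.
- by rewrite ffunE.
- by move=> y _; rewrite ffunE inE.
- by move=> y; rewrite inE => /eqP ->; exists 0%N.
- by move=> y; rewrite inE; exact: ro.
by exists pi.
Qed.

End ParentFunctions.

Section WilsonLaw.
Local Open Scope classical_set_scope.
Variables (R : realType) (V : finType) (e : rel V) (r : V).
Hypothesis e_out : forall x, exists y, e x y.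
Notation p := (step_prob e R).
Hypothesis r_absorbing : absorbing p [set r]%SET.
Variables (d : measure_display) (Omega : measurableType d).
Variables (P : probability Omega R) (X : V -> nat -> Omega -> V).
Hypothesis X_walks : wilson_walks e P r X.
Implicit Types (pi : {ffun V -> V}) (t : {set V}) (o : seq V).
Notation walks w := (fun x k => X x k w).

Let X_srw x : x != r -> srw e P x (X x). Proof. by case: X_walks => H _; exact: H. Qed.

Lemma process_sigma_algebra x : sigma_algebra setT (process_sigma (X x)).
Proof. exact: smallest_sigma_algebra. Qed.

Lemma process_sigma_gen x k y : process_sigma (X x) [set w | X x k w = y].
Proof. by apply: sub_sigma_algebra; exists k, y. Qed.

Lemma process_sigma_measurable x E : x != r ->
  process_sigma (X x) E -> measurable E.
Proof.
move=> xr; apply: smallest_sub; first exact: sigma_algebra_measurable.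
by move=> _ [k [y ->]]; case: (X_srw xr).
Qed.

Lemma process_sigma_branch x t (Q : set (seq V)) :
  process_sigma (X x) [set w | Q (branch t (X x ^~ w))].
Proof.
exact: (determined_branch (process_sigma_algebra x) (@process_sigma_gen x)).
Qed.

Lemma process_sigma_prefix x k (Q : set (seq V)) :
  process_sigma (X x) [set w | Q (mkseq (X x ^~ w) k)].
Proof.
exact: (determined_prefix (process_sigma_algebra x) (@process_sigma_gen x)).
Qed.

Lemma pr_indep (A : V -> set Omega) :
  (forall x, x != r -> process_sigma (X x) (A x)) ->
  pr P [set w | forall x, x != r -> A x w] = \prod_(x | x != r) pr P (A x).
Proof.
move=> sA; have [_ /(_ A)] := X_walks.
have D x : (x \in [set~ r]%SET) = (x != r) by rewrite !inE.
rewrite /pr => ind; transitivity (fine (P [set w | forall x, x \in [set~ r]%SET -> A x w])).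
  by congr (fine (P _)); apply/seteqP; split=> w /= H x; move: (H x); rewrite D.
rewrite ind; last by move=> x; rewrite D; exact: sA.
rewrite (eq_bigr (fun x => (pr P (A x))%:E)) => [|x]; last first.
  by rewrite D => xr; apply: prE; apply: (process_sigma_measurable xr); exact: sA.
rewrite -(big_morph _ (fun a b => EFinM a b) erefl) /=.
by apply: eq_bigl => x; rewrite D.
Qed.

Lemma path_weight_fpath (f : V -> V) x g : fpath f x g ->
  path_weight p x g = \prod_(y <- belast x g) p y (f y).
Proof.
elim: g x => [|y g IH] x /=; first by rewrite big_nil.
by move=> /andP[/eqP <- /IH ->]; rewrite big_cons.
Qed.

(** A vertex already covered when its turn comes gets the full event, any other one the event that
    its walk has the prescribed branch. The resulting product no longer mentions [o]: this is the
    source of the independence of the order. *)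
Lemma agrees_indep pi t o : rooted r pi -> uniq o -> r \notin o -> r \in t ->
  (forall y, y \notin t -> y \in o) ->
  exists A : V -> set Omega,
    [/\ forall x, process_sigma (X x) (A x),
        forall w, agrees pi t o (walks w) <-> (forall x, x \in o -> A x w)
      & \prod_(x <- o) pr P (A x) = (\prod_(y | y \notin t) p y (pi y)) / kdet p t].
Proof.
move=> gpi; elim: o t => [|x o IH] t.
  move=> _ _ rt to; exists (fun=> setT); split=> //.
    by move=> x; apply: sigma_setT; exact: process_sigma_algebra.
  have -> : t = [set: V]%SET by apply/setP => y; rewrite inE; apply/negPn/negP => /to.
  by rewrite kdetT divr1 big_nil big_pred0 // => y; rewrite inE.
rewrite cons_uniq inE negb_or eq_sym => /andP[xo uo] /andP[xr ro] rt to.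
pose upd (E : set Omega) (A : V -> set Omega) y := if y == x then E else A y.
have updx E A : upd E A x = E by rewrite /upd eqxx.
have updo E A y : y \in o -> upd E A y = A y.
  by move=> yo; rewrite /upd; case: eqP => // yx; move: xo; rewrite -yx yo.
have updprod E A : \prod_(y <- x :: o) pr P (upd E A y) =
    pr P E * \prod_(y <- o) pr P (A y).
  by rewrite big_cons updx; congr (_ * _); apply: eq_big_seq => y yo; rewrite updo.
have updall E A w : (forall y, y \in x :: o -> upd E A y w) <->
    (E w /\ forall y, y \in o -> A y w).
  split=> [H|[Ew H] y].
    split=> [|y yo]; first by rewrite -(updx E A); apply: H; exact: mem_head.
    by rewrite -(updo E A) //; apply: H; rewrite inE yo orbT.
  by rewrite inE => /orP[/eqP ->|yo]; rewrite ?updx // updo //; exact: H.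
have updS E A : process_sigma (X x) E -> (forall y, process_sigma (X y) (A y)) ->
    forall y, process_sigma (X y) (upd E A y).
  by move=> SE SA y; rewrite /upd; case: eqP => [->|].
have [xt|xt] := boolP (x \in t).
  have [y yt|A [SA agA prA]] := IH t uo ro rt.
    have := to y yt; rewrite inE => /orP[/eqP yx|//].
    by rewrite yx xt in yt.
  exists (upd setT A); split.
  - by apply: updS => //; apply: sigma_setT; exact: process_sigma_algebra.
  - by move=> w; rewrite updall /= xt agA; split=> [|[]].
  - by rewrite updprod prT mul1r.
have [g [E vg pg]] := branch_parent x gpi rt.
have [|y|A [SA agA prA]] := IH (t :|: [set y in x :: g]%SET) uo ro.
- by rewrite inE rt.
- rewrite !inE !negb_or => /andP[yt /andP[yx _]].
  by have := to y yt; rewrite inE (negbTE yx).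
exists (upd [set w | branch t (X x ^~ w) = x :: g] A); split.
- by apply: updS => //; exact: (@process_sigma_branch x t [set s | s = x :: g]).
- move=> w; rewrite updall /= (negbTE xt) E; split=> [/andP[/eqP Ew /agA]//|].
  by case=> -> /agA ->; rewrite eqxx.
have a_t : absorbing p t.
  apply: absorbingS r_absorbing; first exact: step_prob_ge0.
  by rewrite finset.sub1set.
rewrite updprod prA (pr_branch e_out (X_srw xr) a_t xt vg).
rewrite (path_weight_fpath pg) (bigID (mem (belast x g)) (fun y => y \notin t)) /=.
have yE y : (y \in belast x g) = (y \notin t) && (y \in x :: g).
  by have /setP/(_ y) := ends_first_in_out vg; rewrite !inE => <-.
have -> : \prod_(y | (y \notin t) && (y \in belast x g)) p y (pi y) =
    \prod_(y <- belast x g) p y (pi y).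
  rewrite big_uniq; last first.
    by have /and3P[] := vg; rewrite lastI rcons_uniq => /andP[].
  by apply: eq_bigl => y; rewrite yE andbA andbb.
have -> : \prod_(y | (y \notin t) && (y \notin belast x g)) p y (pi y) =
    \prod_(y | y \notin t :|: [set y in x :: g]%SET) p y (pi y).
  by apply: eq_bigl => y; rewrite yE !inE negb_or; case: (y \in t).
have k0 t' : r \in t' -> kdet p t' != 0.
  move=> rt'; apply: (kdet_neq0 (@step_prob_ge0 _ _ _) (step_prob_sum1 R e_out)).
  apply: absorbingS r_absorbing; first exact: step_prob_ge0.
  by rewrite finset.sub1set.
field; rewrite k0 //= k0 // inE rt //.
Qed.

Definition wilson_order o := uniq o /\ forall y, (y \in o) = (y != r).

Lemma pr_agrees pi o : rooted r pi -> wilson_order o ->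
  pr P [set w | agrees pi [set r]%SET o (walks w)] =
  (\prod_(y | y != r) p y (pi y)) / kdet p [set r]%SET.
Proof.
move=> gpi [uo oE].
have [||y|A [SA agA prA]] := agrees_indep gpi uo (t := [set r]%SET).
- by rewrite oE eqxx.
- by rewrite inE.
- by rewrite inE oE.
rewrite (eq_bigl (fun y => y \notin [set r]%SET)) => [|y]; last by rewrite inE.
rewrite -prA big_uniq // (eq_bigl _ _ oE) -pr_indep //.
by congr pr; apply/seteqP; split=> w /= => [/agA H x xr|H];
  [apply: H; rewrite oE|apply/agA => x; rewrite oE; exact: H].
Qed.

Lemma measurable_agrees pi o : rooted r pi -> wilson_order o ->
  measurable [set w | agrees pi [set r]%SET o (walks w)].
Proof.
move=> gpi [uo oE].
have [||y|A [SA agA _]] := agrees_indep gpi uo (t := [set r]%SET).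
- by rewrite oE eqxx.
- by rewrite inE.
- by rewrite inE oE.
rewrite (_ : [set w | _] = \bigcap_(x in [set x | x \in o]) A x); last first.
  by apply/seteqP; split=> w /=; [move/agA|move=> H; exact/agA].
apply: fin_bigcap_measurable => [|x /=]; first exact: finite_finset.
by rewrite oE => xr; exact: (process_sigma_measurable xr (SA x)).
Qed.

(** The almost sure event on which [agrees_exists] applies. *)
Definition proper w := forall x, x != r ->
  X x 0%N w = x /\ exists k, X x k w = r.

Lemma measurable_proper : measurable [set w | proper w].
Proof.
rewrite (_ : [set w | _] = \bigcap_(x in [set x | x != r])
    ([set w | X x 0%N w = x] `&` \bigcup_k [set w | X x k w = r])); last first.
  apply/seteqP; split=> w /= H x xr; have := H x xr.
    by case=> ? [k ?]; split=> //; exists k.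
  by case=> ? [k _ ?]; split=> //; exists k.
apply: fin_bigcap_measurable => [|x /= xr]; first exact: finite_finset.
have [mX _ _] := X_srw xr.
by apply: measurableI => //; exact: bigcupT_measurable.
Qed.

Lemma pr_proper : pr P [set w | proper w] = 1.
Proof.
have mp := measurable_proper.
apply/eqP; rewrite -subr_eq0 -oppr_eq0 opprB -pr_setC // eq_le pr_ge0 andbT.
(* The flag selects which of the two requirements on the walk fails; the complement is covered by
   these finitely many null events. *)
pose N (xb : V * bool) := if xb.2 then ~` [set w | X xb.1 0%N w = xb.1]
  else [set w | forall k, X xb.1 k w \notin [set r]%SET].
pose Q := [pred xb : V * bool | xb.1 != r].
have mN xb : Q xb -> measurable (N xb).
  case: xb => x b /= xr; have [mX _ _] := X_srw xr; rewrite /N /=.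
  case: b; first exact: measurableC.
  rewrite (_ : [set w | _] = \bigcap_k ~` [set w | X x k w = r]).
    by apply: bigcapT_measurable => k; exact: measurableC.
  apply/seteqP; split=> w /= H k; last by rewrite inE; apply/eqP; exact: H.
  by move=> _ /eqP; have := H k; rewrite inE => /negbTE ->.
apply: le_trans (pr_union_le P (Q := Q) (F := N) _ mN _) _.
- exact: measurableC.
- move=> w /= nw; apply: contrapT => H; apply: nw => x xr.
  split; apply: contrapT => nX; apply: H.
    by exists (x, true).
  exists (x, false) => //= k; rewrite inE; apply/eqP => kr.
  by apply: nX; exists k.
rewrite big1 // => -[x b] /= xr; rewrite /N /=; have [mX P0 _] := X_srw xr.
case: b; last exact: (pr_never e_out (X_srw xr) r_absorbing).
by rewrite pr_setC // (pr_start (X_srw xr)) subrr.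
Qed.

Lemma determined_wilson_step (T : subgraph V) x : x != r ->
  determined (@measurable _ Omega) (fun w => wilson_step (walks w) T x).
Proof.
move=> xr; have -> : (fun w => wilson_step (walks w) T x) =
    if x \in T.1 then fun=> T else fun w => add_path T (branch T.1 (X x ^~ w)).
  by apply/funext => w; rewrite /wilson_step; case: ifP.
case: ifP => _.
  by apply: determined_cst; exact: sigma_algebra_measurable.
by move=> Q; exact: (measurable_branch (X_srw xr) T.1 [set s | Q (add_path T s)]).
Qed.

Lemma determined_wilson o : wilson_order o ->
  determined (@measurable _ Omega) (fun w => wilson (walks w) r o).
Proof.
move=> [uo oE].
have nr x : x \in o -> x != r by rewrite oE.
rewrite /wilson; generalize (([set r]%SET, finset.set0) : subgraph V) => T {uo oE}.
elim/last_ind: o nr => [|o x IH] nr.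
  by apply: determined_cst; exact: sigma_algebra_measurable.
have -> : (fun w => foldl (wilson_step (walks w)) T (rcons o x)) =
    (fun w => wilson_step (walks w) (foldl (wilson_step (walks w)) T o) x).
  by apply/funext => w; rewrite foldl_rcons.
apply: (@determined_bind _ _ (sigma_algebra_measurable Omega) (subgraph V) _
  _ (fun T' w => wilson_step (walks w) T' x)) => [|T'].
  by apply: IH => y yo; apply: nr; rewrite mem_rcons inE yo orbT.
apply: determined_wilson_step; apply: nr; rewrite mem_rcons; exact: mem_head.
Qed.

Definition step_edges pi := forall y, y != r -> e y (pi y).

Lemma measurable_wilson_event s o (Q : set (subgraph V * seq V)) :
  wilson_order (s :: o) -> measurable [set w |
    Q (wilson (walks w) r (s :: o), branch [set r]%SET (X s ^~ w))].
Proof.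
move=> os; have sr : s != r by case: os => _ <-; exact: mem_head.
apply: (@determined_bind _ _ (sigma_algebra_measurable Omega) (subgraph V) _
  _ (fun T w => (T, branch [set r]%SET (X s ^~ w)))) => [|T Q'].
  exact: determined_wilson.
exact: (measurable_branch (X_srw sr) [set r]%SET [set g | Q' (T, g)]).
Qed.

(** The tree and the branch of [s] are read off [pi] alone; the order enters only through the run
    that must agree with [pi]. Keeping [pi] also gives access to the branch of any other vertex. *)
Definition parent_event s o (Q : set (subgraph V * seq V)) : set Omega :=
  [set w | exists pi, [/\ rooted r pi, step_edges pi,
     Q (parent_tree r pi, branch [set r]%SET (parent_walk pi s))
     & agrees pi [set r]%SET (s :: o) (walks w)]].

Lemma measurable_parent_event s o Q : wilson_order (s :: o) ->
  measurable (parent_event s o Q).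
Proof.
move=> os; rewrite (_ : parent_event _ _ _ = \bigcup_(pi in
    [set pi | [/\ rooted r pi, step_edges pi &
      Q (parent_tree r pi, branch [set r]%SET (parent_walk pi s))]])
    [set w | agrees pi [set r]%SET (s :: o) (walks w)]); last first.
  by apply/seteqP; split=> w [pi []]; [exists pi|move=> ? ? ? ?; exists pi].
apply: fin_bigcup_measurable; first exact: finite_finset.
by move=> pi [gpi _ _]; exact: measurable_agrees.
Qed.

(* Both orders give every parent function the same probability. *)
Lemma pr_wilson_reorder s o o' (Q : set (subgraph V * seq V)) :
  wilson_order (s :: o) -> wilson_order (s :: o') ->
  pr P [set w | Q (wilson (walks w) r (s :: o), branch [set r]%SET (X s ^~ w))]
  <= pr P (parent_event s o' Q).
Proof.
move=> os os'.
have sr : s != r by case: os => _ <-; exact: mem_head.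
pose K := [pred pi | `[< rooted r pi /\
  Q (parent_tree r pi, branch [set r]%SET (parent_walk pi s)) >]].
pose E o pi := [set w | agrees pi [set r]%SET o (walks w)].
have mE o1 pi : wilson_order o1 -> K pi -> measurable (E o1 pi).
  by move=> ? /asboolP[? _]; exact: measurable_agrees.
have mQ : measurable [set w |
    Q (wilson (walks w) r (s :: o), branch [set r]%SET (X s ^~ w))].
  exact: measurable_wilson_event.
rewrite (pr_setI1 mQ measurable_proper pr_proper).
apply: le_trans (pr_union_le P (Q := K) (F := E (s :: o)) _ _ _) _.
- exact: measurableI measurable_proper.
- by move=> pi; exact: mE.
- move=> w [Qw pw].
  have [||y|pi gpi ag] := @agrees_exists _ r (walks w) (s :: o).
  + by move=> x /pw[].
  + by move=> x /pw[].
  + by case: os => _ ->.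
  exists pi => //; apply/asboolP; split=> //; move: Qw => /=.
  rewrite /wilson (@agrees_wilson _ pi ([set r]%SET, finset.set0)) //.
  rewrite -/(wilson _ r (s :: o)) (wilson_parent gpi); last by case: os => _ H y; rewrite H.
  move: ag; rewrite /= inE (negbTE sr) => /andP[/eqP -> _].
  by [].
(* A parent function with a step along a non-edge has weight 0. Dropping it here guarantees that the
   branches of the remaining ones are paths of the graph. *)
pose K' := [pred pi | K pi && `[< step_edges pi >]].
have -> : \sum_(pi | K pi) pr P (E (s :: o) pi) = \sum_(pi | K' pi) pr P (E (s :: o') pi).
  rewrite (bigID (fun pi => `[< step_edges pi >])) /= [X in _ + X]big1 ?addr0 => [|pi].
    by apply: eq_bigr => pi /andP[/asboolP[gpi _] _]; rewrite !pr_agrees.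
  move=> /andP[/asboolP[gpi _] /asboolP ne]; rewrite pr_agrees //.
  have [y yr ny] : exists2 y, y != r & ~~ e y (pi y).
    apply: contrapT => H; apply: ne => y yr; apply: contrapT => ny.
    by apply: H; exists y => //; apply/negP.
  by rewrite (bigD1 y) //= /step_prob (negbTE ny) !mul0r.
rewrite -(@pr_bigcup _ _ _ P _ K') => [|pi /andP[Kpi _]|pi pi' w].
- rewrite le_eqVlt; apply/orP; left; apply/eqP; congr pr; apply/seteqP; split=> w /=.
    by case=> pi /andP[/asboolP[? ?] /asboolP ?] ?; exists pi.
  case=> pi [? ? ? ?]; exists pi => //.
  by apply/andP; split; apply/asboolP.
- exact: mE.
move=> /andP[/asboolP[gpi _] _] /andP[/asboolP[gpi' _] _] ag ag'.
apply/ffunP => y; have [->|yr] := eqVneq y r; first by rewrite gpi.1 gpi'.1.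
apply: (agrees_inj gpi gpi' _ ag ag'); rewrite ?inE //.
by case: os' => _ /(_ y); rewrite inE yr.
Qed.

End WilsonLaw.

(** * Distance to the first branch *)

Section GraphDistance.
Variables (V : finType) (e : rel V).

Lemma gdist_le_path x q : path e x q -> (gdist e x (last x q) <= size q)%N.
Proof.
move=> pq; rewrite /gdist; set a := (fun k : nat => _).
(* The search runs over lengths below [#|V|] and returns at most [#|V|], so a longer path satisfies
   the bound trivially. *)
have [lt|le] := ltnP (size q) #|V|; last first.
  by apply: leq_trans le; rewrite -[leqRHS](size_iota 0); exact: find_size.
rewrite leqNgt; apply/negP => qlt.
have := before_find 0%N qlt; rewrite nth_iota // add0n /a => /existsP[].
by exists (in_tuple q); rewrite /= pq eqxx.
Qed.

Lemma gdist_to_le x s u : u \in s -> (gdist_to e x s <= gdist e x u)%N.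
Proof.
rewrite /gdist_to; elim: s => // a s IH; rewrite inE big_cons geq_min.
by case/orP=> [/eqP ->|/IH ->]; rewrite ?leqnn ?orbT.
Qed.

Lemma path_fpath (f : V -> V) x g : fpath f x g ->
  (forall y, y \in belast x g -> e y (f y)) -> path e x g.
Proof.
elim: g x => //= y g IH x /andP[/eqP <- fg] ef.
rewrite ef ?mem_head //=; apply: IH => // z zg.
by apply: ef; rewrite inE zg orbT.
Qed.

End GraphDistance.

(** * From reachability in the graph to bounds on survival *)

Section Reachability.
Variables (R : realType) (V : finType) (e : rel V).
Implicit Type A : {set V}.

Fixpoint reach A k x : bool :=
  (x \in A) || (if k is k'.+1 then [exists y, e x y && reach A k' y] else false).

Lemma reachS A k x : reach A k x -> reach A k.+1 x.
Proof.
elim: k x => [|k IH] x; first by rewrite /= orbF => ->.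
case/orP=> [xA|/existsP[y /andP[xy yA]]]; first by rewrite /= xA.
by apply/orP; right; apply/existsP; exists y; apply/andP; split=> //; exact: IH.
Qed.

Lemma reach_leq A k l x : (k <= l)%N -> reach A k x -> reach A l x.
Proof.
by move=> /subnK <-; elim: (l - k)%N => // j IH /IH; rewrite addSn; exact: reachS.
Qed.

Variable p : V -> V -> R.
Hypothesis p_ge0 : forall x y, 0 <= p x y.
Hypothesis p_sum1 : forall x, \sum_y p x y = 1.
Variable delta : R.
Hypotheses (delta_gt0 : 0 < delta) (delta_le1 : delta <= 1).
Hypothesis p_ge : forall x y, e x y -> delta <= p x y.

(** The walk follows one fixed path to [A], of at most [k] steps, with probability at least
    [delta ^+ k]. *)
Lemma surv_reach A k x : reach A k x -> surv p A k x <= 1 - delta ^+ k.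
Proof.
have d1 j : delta ^+ j <= 1 by rewrite exprn_ile1 // ltW.
elim: k x => [|k IH] x; first by rewrite /= orbF => ->; rewrite expr0 subrr.
rewrite [reach _ _ _]/= [surv _ _ _ _]/=; case: ifP => [_ _|_ /existsP[y /andP[xy yA]]].
  by rewrite subr_ge0.
rewrite (bigD1 y) //=.
have le1 : \sum_(z | z != y) p x z * surv p A k z <= 1 - p x y.
  rewrite lerBrDl -(p_sum1 x) [leRHS](bigD1 y) //= lerD2l.
  by apply: ler_sum => z _; rewrite ler_piMr // surv_le1.
apply: le_trans (lerD (ler_wpM2l (p_ge0 x y) (IH y yA)) le1) _.
have : delta * delta ^+ k <= p x y * delta ^+ k.
  by rewrite ler_wpM2r ?p_ge // exprn_ge0 // ltW.
by rewrite exprS; lra.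
Qed.

Lemma absorbing_reach A : (forall x, exists k, reach A k x) -> absorbing p A.
Proof.
move=> /fin_all_exists[f Af]; pose K := (\max_x f x)%N.
exists K, (1 - delta ^+ K); split; first by rewrite ltrBlDr ltrDl exprn_gt0.
by move=> x; apply: surv_reach; apply: reach_leq (Af x); exact: leq_bigmax.
Qed.

End Reachability.

Lemma step_prob_ge (R : realType) (V : finType) (e : rel V) (D : nat) x y :
  (#|[set z | e x z]%SET| <= D)%N -> e x y -> D%:R^-1 <= step_prob e R x y.
Proof.
move=> xD xy; rewrite /step_prob xy.
have deg : (0 < #|[set z | e x z]%SET|)%N by apply/card_gt0P; exists y; rewrite inE.
by rewrite lef_pV2 ?ler_nat // posrE ltr0n // (leq_trans deg).
Qed.

Section DistanceTail.
Local Open Scope classical_set_scope.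
Variables (R : realType) (V : finType) (e : rel V) (r : V).
Hypothesis e_out : forall x, exists y, e x y.
Notation p := (step_prob e R).
Hypothesis r_absorbing : absorbing p [set r]%SET.
Variables (d : measure_display) (Omega : measurableType d).
Variables (P : probability Omega R) (X : V -> nat -> Omega -> V).
Hypothesis X_walks : wilson_walks e P r X.
Notation walks w := (fun x k => X x k w).

Lemma pr_indep2 x y E F : x != r -> y != r -> x != y ->
  process_sigma (X x) E -> process_sigma (X y) F ->
  pr P (E `&` F) = pr P E * pr P F.
Proof.
move=> xr yr xy SE SF.
pose A z := if z == x then E else if z == y then F else setT.
have Ax : A x = E by rewrite /A eqxx.
have Ay : A y = F by rewrite /A eq_sym (negbTE xy) eqxx.
have AT z : z != x -> z != y -> A z = setT.
  by rewrite /A => /negbTE -> /negbTE ->.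
have SA z : z != r -> process_sigma (X z) (A z).
  rewrite /A => zr; case: eqP => [->//|_]; case: eqP => [->//|_].
  by apply: sigma_setT; exact: process_sigma_algebra.
have := pr_indep X_walks SA; rewrite (bigD1 x) //= (bigD1 y) /=; last by rewrite yr eq_sym.
rewrite big1 => [|z /andP[/andP[_ zx] zy]]; last by rewrite AT ?prT.
rewrite mulr1 Ax Ay => <-; congr pr; apply/seteqP; split=> w /=.
  move=> [Ew Fw] z _; have [->|zx] := eqVneq z x; first by rewrite Ax.
  by have [->|zy] := eqVneq z y; [rewrite Ay|rewrite AT].
by move=> H; split; [rewrite -Ax|rewrite -Ay]; exact: H.
Qed.

(* With [v] explored right after [s], the distance from [v] to the first branch
   is at most the time the walk from [v] needs to hit it. *)
Lemma pr_gdist_to_le s o v l b : 0 <= b -> wilson_order r (s :: o) ->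
  (forall g, path e s g -> last s g = r ->
     surv p [set y in s :: g]%SET l v <= b) ->
  pr P [set w | (l < gdist_to (sg_adj (wilson (walks w) r (s :: o))) v
                        (branch [set r]%SET (X s ^~ w)))%N] <= b.
Proof.
move=> b0 os Hb.
pose Q := [set TL : subgraph V * seq V | (l < gdist_to (sg_adj TL.1) v TL.2)%N].
have sr : s != r by case: os => _ <-; exact: mem_head.
have notin pi : Q (parent_tree r pi, branch [set r]%SET (parent_walk pi s)) ->
    v \notin branch [set r]%SET (parent_walk pi s).
  rewrite /Q /= => lt; apply/negP => vL.
  have := leq_trans lt (gdist_to_le _ _ vL).
  by rewrite ltnNge (leq_trans (@gdist_le_path _ _ v [::] _)).
have branchE pi : rooted r pi -> step_edges e r pi -> exists g,
    [/\ branch [set r]%SET (parent_walk pi s) = s :: g, path e s g & last s g = r].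
  move=> gpi epi; have [|g [E vg pg]] := branch_parent s gpi (_ : r \in [set r]%SET).
    by rewrite inE.
  have /and3P[_ aA lA] := vg; exists g; split=> //; last by move: lA; rewrite inE => /eqP.
  apply: path_fpath pg _ => y /(allP aA) /=; rewrite inE; exact: epi.
(* These two vertices have no place among the later walks, but both lie on the first branch, so the
   event is empty. *)
have [vrs|] := boolP ((v == r) || (v == s)).
  apply: le_trans (pr_wilson_reorder e_out r_absorbing X_walks Q os os) _.
  rewrite (_ : parent_event _ _ _ _ _ _ = set0) ?pr0 //; apply/seteqP; split=> // w.
  move=> [pi [gpi epi /notin/negP nv _]]; exfalso; apply: nv.
  have [g [-> _ lg]] := branchE pi gpi epi.
  by case/orP: vrs => /eqP ->; [rewrite -lg mem_last|rewrite mem_head].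
rewrite negb_or => /andP[vr vs].
have vo : v \in o by case: os => _ /(_ v); rewrite inE (negbTE vs) vr.
have os' : wilson_order r (s :: v :: rem v o).
  case: os => uo oE; have pe : perm_eq (s :: v :: rem v o) (s :: o).
    by rewrite perm_cons perm_sym perm_to_rem.
  by split=> [|y]; [rewrite (perm_uniq pe)|rewrite (perm_mem pe)].
apply: le_trans (pr_wilson_reorder e_out r_absorbing X_walks Q os os') _.
(* The first branch matters to the walk from [v] only through its vertex set, so the event is
   decomposed over the finitely many possible sets. *)
pose crossing := [pred A : {set V} | `[< exists g,
  [/\ path e s g, last s g = r & A = [set y in s :: g]%SET] >]].
pose B A := [set w | [set y in branch [set r]%SET (X s ^~ w)]%SET = A].
pose S (A : {set V}) := [set w | ~~ has (mem A) (mkseq (X v ^~ w) l.+1)].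
have SB A : process_sigma (X s) (B A).
  exact: (@process_sigma_branch _ _ _ X s [set r]%SET [set q : seq V | [set y in q]%SET = A]).
have SS A : process_sigma (X v) (S A).
  exact: (@process_sigma_prefix _ _ _ X v l.+1 [set q : seq V | ~~ has (mem A) q]).
have mB A : measurable (B A) by exact: (process_sigma_measurable X_walks sr).
have mS A : measurable (S A) by exact: (process_sigma_measurable X_walks vr).
have Xv : srw e P v (X v) by case: X_walks => H _; exact: H.
apply: le_trans (pr_union_le P (Q := crossing) (F := fun A => B A `&` S A) _ _ _) _.
- exact: (measurable_parent_event e_out r_absorbing X_walks).
- by move=> A _; exact: measurableI.
- move=> w [pi [gpi epi Qpi]].
  have [g [Eg pg lg]] := branchE pi gpi epi.
  have {notin} := notin pi Qpi; rewrite Eg => vg.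
  have rg : r \in s :: g by rewrite -lg mem_last.
  rewrite /= inE (negbTE sr) Eg => /andP[/eqP Es].
  have tE : ([set r] :|: [set y in s :: g] = [set y in s :: g])%SET.
    by apply/finset.setUidPr; rewrite finset.sub1set inE.
  have vt : v \notin [set y in s :: g]%SET by rewrite inE.
  rewrite tE (negbTE vt) => /andP[/eqP Ev _].
  have rt : r \in [set y in s :: g]%SET by rewrite inE.
  have [h [Eh vh ph]] := branch_parent v gpi rt.
  exists [set y in s :: g]%SET; first by apply/asboolP; exists g.
  split; first by rewrite /B /= Es.
  have /and3P[_ ah lh] := vh.
  (* A walk that never hits would have the default branch [[::]], whereas this branch starts with
     [v]. *)
  have hA : exists k, X v k w \in [set y in s :: g]%SET.
    apply: contrapT => nA; move: Ev; rewrite Eh /branch /stopped_path.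
    by case: pselect.
  have [h' [Eh' _ avoid]] := branch_ends_first hA.
  have hh' : h' = h by move: Eh'; rewrite Ev Eh => -[].
  have pT : path (sg_adj (parent_tree r pi)) v h.
    apply: path_fpath ph _ => y /(allP ah) /= yt; rewrite /sg_adj /=.
    apply/imsetP; exists y => //; rewrite !inE.
    by apply: contraNneq yt => ->.
  (* The branch [h] joins [v] to the first branch inside the tree, so it is at least as long as the
     distance. The walk then avoids the first branch at the [l.+1] times from 0 to [l]. *)
  have lt : (l < size h)%N.
    apply: leq_trans (leq_trans _ (gdist_le_path pT)); last first.
      by apply: gdist_to_le; rewrite inE in lh; exact: lh.
    by move: Qpi; rewrite /Q /= Eg.
  suff: ~~ has (mem [set y in s :: g]%SET) (mkseq (X v ^~ w) l.+1) by [].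
  apply/hasPn => _ /mapP[k + ->]; rewrite mem_iota add0n => /andP[_ kl].
  by apply: (avoid l.+1) => //; rewrite hh'.
apply: (@le_trans _ _ (\sum_(A | crossing A) pr P (B A) * b)).
  apply: ler_sum => A /asboolP[g [pg lg ->]].
  rewrite (pr_indep2 sr vr _ (SB _) (SS _)) 1?eq_sym //.
  by rewrite ler_wpM2l ?pr_ge0 // (pr_avoid Xv) Hb.
(* The events [B A] are disjoint, so their probabilities add up to at most 1. *)
rewrite -mulr_suml ler_piMl // -(@pr_bigcup _ _ _ P _ crossing B) => [|//|A A' w _ _ <- <-//].
rewrite (_ : [set w | _] = \bigcup_(A in [set A | crossing A]) B A); last first.
  by apply/seteqP; split=> w [A cA BA]; exists A.
by apply: pr_le1; apply: fin_bigcup_measurable => //; exact: finite_finset.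
Qed.

End DistanceTail.

(** * Degrees, reachability and crossings in the cylinder *)

Section Cylinder.
Variables (n m : nat).
Notation N := n.+3.
Notation cylN := (cyl N m).
Notation adj := (@cyl_adj N m).
Implicit Types (x y : cylN) (A : {set cylN}).

Lemma cyl_out x : exists y, adj x y.
Proof. by exists (x.1 + 1, x.2); rewrite /cyl_adj /= !eqxx. Qed.

Lemma cyl_degree x : (#|[set z | adj x z]%SET| <= 4)%N.
Proof.
pose up := [set z : cylN | (z.1 == x.1) && (z.2 == x.2.+1 :> nat)]%SET.
pose down := [set z : cylN | (z.1 == x.1) && (x.2 == z.2.+1 :> nat)]%SET.
have up1 : (#|up| <= 1)%N.
  apply/card_le1_eqP => -[a b] [a' b']; rewrite !inE /=.
  move=> /andP[/eqP -> /eqP E] /andP[/eqP -> /eqP E']; congr pair.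
  by apply: val_inj; rewrite /= E E'.
have down1 : (#|down| <= 1)%N.
  apply/card_le1_eqP => -[a b] [a' b']; rewrite !inE /=.
  move=> /andP[/eqP -> /eqP E] /andP[/eqP -> /eqP E']; congr pair.
  by apply: val_inj; move: E' => /=; rewrite E => -[].
have sub : [set z | adj x z]%SET \subset
    ([set (x.1 + 1, x.2)] :|: [set (x.1 - 1, x.2)] :|: up :|: down)%SET.
  apply/fintype.subsetP => -[a b]; rewrite !inE /cyl_adj /= !xpair_eqE.
  case/orP=> /andP[/eqP <-].
    by case/orP=> /eqP ->; rewrite ?addrK !eqxx ?orbT.
  by case/orP=> ->; rewrite eqxx ?orbT.
apply: leq_trans (subset_leq_card sub) _.
apply: leq_trans (leq_card_setU _ _) _; apply: (@leq_add _ _ 3 1) => //.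
apply: leq_trans (leq_card_setU _ _) _; apply: (@leq_add _ _ 2 1) => //.
by apply: leq_trans (leq_card_setU _ _) _; rewrite !cards1.
Qed.

(** Turning always in the direction [+ 1] reaches any vertex of the ring in fewer than [N] steps;
    this is where independence of [m] comes from. *)
Lemma reach_ring A x (i : 'Z_N) : (i, x.2) \in A -> reach adj A N x.
Proof.
move=> iA; have [j jN jA] : exists2 j, (j <= N)%N & (x.1 + j%:R, x.2) \in A.
  exists ((i - x.1)%R : 'Z_N); first exact: ltnW (ltn_ord _).
  by rewrite natr_Zp addrC subrK.
apply: reach_leq jN _.
elim: j x jA {i iA} => [|j IH] [a k] jA.
  by move: jA; rewrite mulr0n addr0 /= orbF.
apply/orP; right; apply/existsP; exists (a + 1, k).
apply/andP; split; first by rewrite /cyl_adj !eqxx.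
by apply: IH; move: jA; rewrite [(_, _).1]/= [(_, _).1]/= -addrA -mulrS.
Qed.

(** The number of steps may grow with [m]; only its finiteness is needed, to have absorption at the
    root. *)
Lemma reach_root (r x : cylN) : exists k, reach adj [set r]%SET k x.
Proof.
(* With truncated subtraction this sum is the distance between the two rings; each induction step
   moves one ring closer to the root. *)
case: r => i b; have [D] : exists D, ((x.2 - b) + (b - x.2) = D)%N by eexists.
elim: D x => [|D IH] [j a] /=.
  move=> E; exists N; apply: (@reach_ring _ _ i); rewrite inE /=.
  by have -> : a = b by apply: ord_inj; lia.
have step a' : cyl_adj (j, a) (j, a') -> ((a' - b) + (b - a') = D)%N ->
    exists k, reach adj [set (i, b)]%SET k (j, a).
  move=> aa' /(IH (j, a'))[k kr]; exists k.+1.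
  by apply/orP; right; apply/existsP; exists (j, a'); rewrite aa'.
have [lt|le] := ltnP a b => E.
  have am : (a.+1 < m)%N by apply: leq_ltn_trans lt _.
  by apply: (step (Ordinal am)); rewrite /= ?/cyl_adj /= ?eqxx ?orbT //; lia.
have am : (a.-1 < m)%N by apply: leq_ltn_trans (leq_pred _) _.
apply: (step (Ordinal am)); last by rewrite /=; lia.
by rewrite /cyl_adj /= eqxx /=; apply/orP; right; apply/orP; right; apply/eqP; lia.
Qed.

(** A discrete intermediate value theorem: an edge changes the ring index by at most one. *)
Lemma path_crosses x g k : path adj x g ->
  (minn x.2 (last x g).2 <= k <= maxn x.2 (last x g).2)%N ->
  exists2 y, y \in x :: g & y.2 = k :> nat.
Proof.
have base a : (minn a a <= k <= maxn a a)%N -> a = k by lia.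
have next a b c : (minn a c <= k <= maxn a c)%N -> a != k ->
    b = a.+1 \/ a = b.+1 -> (minn b c <= k <= maxn b c)%N by lia.
elim: g x => [|y g IH] x /=.
  by move=> _ kx; exists x; [exact: mem_head|exact: base].
move=> /andP[xy yg] kx; have [xk|xk] := eqVneq (x.2 : nat) k.
  by exists x; rewrite ?mem_head.
have [|z zg zk] := IH y yg; last by exists z; rewrite // inE zg orbT.
move: xy; rewrite /cyl_adj => /orP[/andP[/eqP <- _]//|].
by move=> /andP[_ yx]; apply: next kx xk _; case/orP: yx => /eqP; [left|right].
Qed.

Lemma reach_crossing x g v : path adj x g ->
  (x \in ring_of N m 0) && (last x g \in ring_of N m m.-1) ||
  (x \in ring_of N m m.-1) && (last x g \in ring_of N m 0) ->
  reach adj [set y in x :: g]%SET N v.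
Proof.
rewrite !inE => pg ends; have vm := ltn_ord v.2.
have [|y yg yv] := @path_crosses x g v.2 pg.
  have bnd k : (k < m)%N -> (minn 0 m.-1 <= k <= maxn 0 m.-1)%N by lia.
  by case/orP: ends => /andP[/eqP -> /eqP ->]; [|rewrite minnC maxnC]; exact: bnd.
apply: (@reach_ring _ _ y.1); rewrite inE.
suff -> : (y.1, v.2) = y by [].
by rewrite [RHS]surjective_pairing; congr pair; exact/esym/val_inj.
Qed.

End Cylinder.

(** Bernoulli's inequality, which replaces the extraction of a root in the choice of [theta]. *)
Lemma bernoulli_le (R : realFieldType) (a : R) k : 0 <= a <= 1 ->
  1 - k%:R * a <= (1 - a) ^+ k.
Proof.
move=> /andP[a0 a1]; elim: k => [|k IH]; first by rewrite mul0r subr0 expr0.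
rewrite exprS.
have h : (1 - a) * (1 - k%:R * a) <= (1 - a) * (1 - a) ^+ k.
  by rewrite ler_wpM2l // subr_ge0.
apply: le_trans h; rewrite -addn1 natrD.
have : 0 <= k%:R * (a * a) by rewrite mulr_ge0 ?mulr_ge0.
by lra.
Qed.

Theorem mainTheorem4 (R : realType) (n : nat) (hn : (3 <= n)%N) :
  exists C theta : R, [/\ 0 < theta, theta < 1 &
  forall m : nat, (2 <= m)%N ->
  forall (r s : cyl n m) (ord : seq (cyl n m)),
    (r \in ring_of n m 0) && (s \in ring_of n m m.-1) ||
    (r \in ring_of n m m.-1) && (s \in ring_of n m 0) ->
    perm_eq [:: r, s & ord] (enum (cyl n m)) ->
  forall (d : measure_display) (Omega : measurableType d)
    (P : probability Omega R) (X : cyl n m -> nat -> Omega -> cyl n m),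
    wilson_walks (@cyl_adj n m) P r X ->
  let T := fun w : Omega => wilson (fun x k => X x k w) r (s :: ord) in
  let L := fun w : Omega => branch [set r]%SET (fun k => X s k w) in
  forall (v : cyl n m) (l : nat),
    (P [set w | (l <= gdist_to (sg_adj (T w)) v (L w))%N]%classic
       <= (C * theta ^+ l)%:E)%E].
Proof.
case: n hn => [|[|[|n]]] // _.
pose delta : R := 4%:R^-1.
have delta_gt0 : 0 < delta by rewrite invr_gt0 ltr0n.
have delta_le1 : delta <= 1 by rewrite invf_le1 ?ltr0n // ler1n.
(* Chosen so that [n.+3%:R * a = delta ^+ n.+3]; Bernoulli's inequality then gives
   [1 - delta ^+ n.+3 <= theta ^+ n.+3], so [theta] dominates the survival rate per step. *)
pose a := delta ^+ n.+3 / n.+3%:R.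
have a_gt0 : 0 < a by rewrite divr_gt0 ?exprn_gt0 ?ltr0n.
have a_lt1 : a < 1.
  rewrite ltr_pdivrMr ?ltr0n // mul1r.
  by apply: le_lt_trans (_ : 1 < _); rewrite ?exprn_ile1 ?ltr1n // ltW.
pose theta := 1 - a.
have theta_gt0 : 0 < theta by rewrite subr_gt0.
have theta_lt1 : theta < 1 by rewrite ltrBlDr ltrDl.
have theta_q : 1 - delta ^+ n.+3 <= theta ^+ n.+3.
  apply: le_trans (bernoulli_le _ _); last by rewrite !ltW.
  by rewrite [_%:R * a]mulrC divfK ?pnatr_eq0.
(* One factor [theta ^+ n.+3] pays for the last incomplete block of [n.+3] steps. *)
pose C := (theta ^+ n.+3)^-1.
have tN_gt0 : 0 < theta ^+ n.+3 by rewrite exprn_gt0.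
exists C, theta; split=> // m m2 r s ord rs pe d Omega P X X_walks T L v l.
pose e := @cyl_adj n.+3 m.
have e_out : forall x, exists y, e x y by exact: cyl_out.
have p_ge x y : e x y -> delta <= step_prob e R x y.
  by move=> xy; apply: step_prob_ge xy; exact: cyl_degree.
have p0 := @step_prob_ge0 R _ e.
have p1 := step_prob_sum1 R e_out.
have r_abs : absorbing (step_prob e R) [set r]%SET.
  by apply: (absorbing_reach p0 p1 delta_gt0 delta_le1 p_ge) => x; exact: reach_root.
have os : wilson_order r (s :: ord).
  have := perm_uniq pe; rewrite enum_uniq cons_uniq => /andP[ro uo].
  split=> // y; have := perm_mem pe y; rewrite mem_enum inE.
  by have [->|_] := eqVneq y r; first by rewrite (negbTE ro).
have mE := measurable_wilson_event X_walks
  [set TL | (l <= gdist_to (sg_adj TL.1) v TL.2)%N]%classic os.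
rewrite (prE P mE) lee_fin.
(* [pr_gdist_to_le] bounds the strict event [l < dist], that is the case [l.+1]; the case 0 holds
   because [C] is at least 1. *)
case: l mE => [|l] mE.
  by rewrite expr0 mulr1; apply: le_trans (pr_le1 P mE) _; rewrite invf_ge1 // exprn_ile1 // ltW.
pose j := (l %/ n.+3)%N.
have q0 : 0 <= 1 - delta ^+ n.+3 by rewrite subr_ge0 exprn_ile1 // ltW.
apply: le_trans (pr_gdist_to_le e_out r_abs X_walks (b := (1 - delta ^+ n.+3) ^+ j) _ os _) _.
- by rewrite exprn_ge0.
- move=> g pg lg; apply: le_trans (surv_anti p0 p1 _ _ (leq_trunc_div l n.+3)) _.
  apply: (surv_exp p0 p1) => y; apply: (surv_reach p0 p1 delta_gt0 delta_le1 p_ge).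
  by apply: reach_crossing pg _; rewrite lg orbC andbC [X in _ || X]andbC.
apply: (@le_trans _ _ (theta ^+ (j * n.+3))).
  by rewrite mulnC exprM lerXn2r // nnegrE // exprn_ge0 // ltW.
(* What remains is [l.+1 <= j * n.+3 + n.+3]: the remainder of [l] modulo [n.+3] is less than
   [n.+3]. *)
rewrite mulrC ler_pdivlMr // -exprD; apply: ler_wiXn2l; rewrite ?ltW //.
by rewrite {1}(divn_eq l n.+3) ltn_add2l ltn_pmod.
Qed.
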